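(* Let $G$ be an abelian group of finite torsion-free rank, let $T$ be its torsion subgroup and, for each prime $p$, let $T_p$ be the $p$-component of $T$. Then $G$ is semi-generalized co-Bassian if, and only if, for every prime $p$, the group $T_p$ is semi-generalized co-Bassian and at least one of the following holds: (a) $T_p$ has finite $p$-rank; (b) $T_p$ is divisible; (c) $G/T$ is $p$-divisible.
   Context: All groups are abelian, written additively. A subgroup $H$ of a group $A$ is essential in $A$ if $H\cap S\neq\{0\}$ for every non-zero subgroup $S$ of $A$ (so $\{0\}$ is essential in $\{0\}$). A group $G$ is semi-generalized co-Bassian if, for every subgroup $H\leq G$ and every injective homomorphism $\varphi:G\to G/H$, the image $\varphi(G)$ is an essential subgroup of some direct summand of $G/H$. The torsion-free rank of $G$ is the rank of $G/T$, i.e. $\dim_{\mathbb{Q}}(\mathbb{Q}\otimes G)$. The $p$-rank of $T_p$ is the dimension of $T_p[p]=\{x\in T_p: px=0\}$ over the field with $p$ elements. A group $A$ is $p$-divisible if $pA=A$. *)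

(* Defs.v *)
From HB Require Import structures.
From mathcomp Require Import all_boot all_order all_algebra.
From mathcomp Require Import boolp.

Set Implicit Arguments.
Unset Strict Implicit.
Unset Printing Implicit Defensive.

Import GRing.Theory.
Local Open Scope ring_scope.

(** Abelian groups are [zmodType]s, subgroups of [G] are [zmodClosed G], and
    [G/H] is the MathComp quotient [{ideal_quot H}].  A [zmodClosed] predicate is
    boolean, but with the axioms of [boolp] every [Prop]-valued subgroup is of
    this form, through [`[< _ >]]; likewise every abelian group carries a
    choice structure. *)

Section SubgroupType.
Variables (G : zmodType) (H : zmodClosed G).

Definition subgroup : Type := {x : G | x \in H}.

HB.instance Definition _ := [isSub of subgroup for @sval G (fun x => x \in H)].
HB.instance Definition _ := [Choice of subgroup by <:].
HB.instance Definition _ := [SubChoice_isSubZmodule of subgroup by <:].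
End SubgroupType.

Section Image.
Variables (G A : zmodType) (phi : {additive G -> A}).

Definition hom_image (y : A) : bool := `[< exists x : G, phi x = y >].

Fact hom_image_zmod_closed : zmod_closed hom_image.
Proof.
split=> [|_ _ /asboolP[x <-] /asboolP[y <-]]; apply/asboolP.
  by exists 0; rewrite raddf0.
by exists (x - y); rewrite raddfB.
Qed.

HB.instance Definition _ := GRing.isZmodClosed.Build A hom_image hom_image_zmod_closed.
End Image.

Section Torsion.
Variable G : zmodType.

Definition torsion (x : G) : bool := `[< exists2 n, (0 < n)%N & x *+ n = 0 >].

Fact torsion_zmod_closed : zmod_closed torsion.
Proof.
split=> [|x y /asboolP[m m0 xm] /asboolP[n n0 yn]]; apply/asboolP.
  by exists 1%N.
exists (m * n)%N; first by rewrite muln_gt0 m0.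
by rewrite mulrnBl mulrnA xm mul0rn mulnC mulrnA yn mul0rn subrr.
Qed.

HB.instance Definition _ :=
  GRing.isZmodClosed.Build G torsion torsion_zmod_closed.

Variable p : nat.

(** An element of p-power order is torsion, so this is the p-component of the
    torsion subgroup. *)
Definition pcomponent (x : G) : bool :=
  `[< exists k, x *+ (p ^ k)%N = 0 >].

Fact pcomponent_zmod_closed : zmod_closed pcomponent.
Proof.
split=> [|x y /asboolP[m xm] /asboolP[n yn]]; apply/asboolP.
  by exists 0%N; rewrite mul0rn.
exists (m + n)%N; rewrite expnD.
by rewrite mulrnBl mulrnA xm mul0rn mulnC mulrnA yn mul0rn subrr.
Qed.

HB.instance Definition _ :=
  GRing.isZmodClosed.Build G pcomponent pcomponent_zmod_closed.
End Torsion.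

Definition torsion_subgroup (G : zmodType) : zmodClosed G :=
  GRing.ZmodClosed.clone G (@torsion G) _.

Definition pcomponent_subgroup (G : zmodType) (p : nat) : zmodClosed G :=
  GRing.ZmodClosed.clone G (@pcomponent G p) _.

Definition image_subgroup (G A : zmodType) (phi : {additive G -> A}) :
    zmodClosed A :=
  GRing.ZmodClosed.clone A (hom_image phi) _.

Definition essential_in (A : zmodType) (H K : zmodClosed A) : Prop :=
  {subset H <= K} /\
  forall S : zmodClosed A, {subset S <= K} ->
    (exists2 x, x \in S & x != 0) ->
    exists x, [/\ x \in H, x \in S & x != 0].

Definition direct_summand (A : zmodType) (K : zmodClosed A) : Prop :=
  exists L : zmodClosed A,
    (forall x, x \in K -> x \in L -> x = 0) /\
    (forall x, exists y z, [/\ y \in K, z \in L & x = y + z]).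

Definition semi_generalized_co_Bassian (G : zmodType) : Prop :=
  forall (H : zmodClosed G) (phi : {additive G -> {ideal_quot H}}),
    injective phi ->
    exists2 K : zmodClosed {ideal_quot H},
      direct_summand K & essential_in (image_subgroup phi) K.

Definition Z_independent (A : zmodType) (n : nat) (a : 'I_n -> A) : Prop :=
  forall c : 'I_n -> int, \sum_i a i *~ c i = 0 -> forall i, c i = 0.

(** The largest size of a Z-independent family, i.e. dim_Q (Q (x) A). *)
Definition has_rank (A : zmodType) (n : nat) : Prop :=
  (exists a : 'I_n -> A, Z_independent a) /\
  (forall m (a : 'I_m -> A), Z_independent a -> (m <= n)%N).

Definition finite_torsion_free_rank (G : zmodType) : Prop :=
  exists n, has_rank {ideal_quot torsion_subgroup G} n.

(** For p prime: A[p] has an n-element basis over the field 'F_p, a scalar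
    c : 'F_p acting as multiplication by its representative in {0,...,p-1}. *)
Definition has_prank (p : nat) (A : zmodType) (n : nat) : Prop :=
  exists b : 'I_n -> A,
    (forall i, b i *+ p = 0) /\
    (forall x, x *+ p = 0 ->
       exists! c : {ffun 'I_n -> 'F_p}, x = \sum_i b i *+ c i).

Definition finite_prank (p : nat) (A : zmodType) : Prop :=
  exists n, has_prank p A n.

Definition p_divisible (p : nat) (A : zmodType) : Prop :=
  forall x : A, exists y : A, y *+ p = x.

Definition divisible (A : zmodType) : Prop :=
  forall n, (0 < n)%N -> forall x : A, exists y : A, y *+ n = x.

(* Main.v *)
(** Everything rests on transferring the hypothesis on [G] to pairs of
    homomorphisms [q, phi : G -> A] with [q] onto and [phi] injective.

    Suppose [G] is semi-generalized co-Bassian and fix a prime [p].  If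
    [p phi(x)] is divisible by [p^(b+1)] in [A], then, up to an element of
    [phi(G)[p]], [phi(x)] is divisible by [p^b].  This height condition is
    violated by suitable [A] in two situations.  If the heights of the elements
    of [G[p]] are unbounded, a direct sum [C] of cyclic groups of increasing
    orders in [G] maps onto a divisible [p]-group [Q] into which it also embeds,
    and [A = F_p x Q x G/C] works.  Hence [p^n T_p] is divisible for some [n] and
    [T_p] is a direct summand of [G].  If moreover [G/T] is not [p]-divisible,
    [T_p] is not divisible and [T_p[p]] is infinite, then [T_p] has an injective
    endomorphism whose image misses an element [s] of [T_p[p]] even modulo
    [p^b T_p], and one takes [A = G], with [phi] acting on a complement of [T_p]
    as multiplication by [p^b] plus a homomorphism onto the subgroup generated
    by [s].

    Conversely, finiteness of the torsion-free rank forces [H] to be torsion and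
    [phi(G)] to have torsion cokernel in [A = G/H].  For each [p], [phi(T_p)] is
    essential in a summand of [A_p], and in each of the cases (a), (b), (c) the
    projection of [A_p] onto a complement extends to [A] so as to vanish on
    [phi(G)].  The common kernel of these projections is the required summand. *)

Require Import Defs.
From HB Require Import structures.
From mathcomp Require Import all_boot all_order all_algebra.
From mathcomp Require Import boolp classical_sets ring.

Set Implicit Arguments.
Unset Strict Implicit.
Unset Printing Implicit Defensive.

Import GRing.Theory.
Local Open Scope ring_scope.

(** * Subgroups and extension of homomorphisms *)

(** Subgroups are built as plain predicates; [sg_zmodClosed] packs them only where a closed
    predicate is required. *)
Definition is_subgroup (G : zmodType) (S : G -> Prop) : Prop :=
  S 0 /\ forall x y, S x -> S y -> S (x - y).

Section Subgroups.
Variables (G : zmodType) (S : G -> Prop) (hS : is_subgroup S).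

Lemma sg0 : S 0. Proof. by case: hS. Qed.

Lemma sgB x y : S x -> S y -> S (x - y). Proof. by case: hS => _; apply. Qed.

Lemma sgN x : S x -> S (- x).
Proof. by rewrite -sub0r; apply: sgB; exact: sg0. Qed.

Lemma sgD x y : S x -> S y -> S (x + y).
Proof. by move=> Sx Sy; rewrite -[y]opprK; apply: sgB => //; exact: sgN. Qed.

Lemma sgMn x n : S x -> S (x *+ n).
Proof.
by move=> Sx; elim: n => [|n IHn]; [exact: sg0 | rewrite mulrS; apply: sgD].
Qed.

Lemma sgMz x k : S x -> S (x *~ k).
Proof.
by move=> Sx; case: k => n; [|apply: sgN]; exact: sgMn.
Qed.

Lemma sg_zmodClosed : exists H : zmodClosed G, forall x, x \in H <-> S x.
Proof.
have cS : zmod_closed (fun x => `[< S x >]).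
  split=> [|x y /asboolP Sx /asboolP Sy]; apply/asboolP; first exact: sg0.
  exact: sgB.
pose m := GRing.isZmodClosed.Build G (fun x => `[< S x >]) cS.
pose H : zmodClosed G := HB.pack (fun x => `[< S x >]) m.
by exists H => x; split=> /asboolP.
Qed.
End Subgroups.

Lemma closed_is_subgroup (G : zmodType) (H : zmodClosed G) :
  is_subgroup (fun x => x \in H).
Proof. by split=> [|x y]; [exact: rpred0 | exact: rpredB]. Qed.

Lemma image_is_subgroup (G A : zmodType) (f : {additive G -> A}) :
  is_subgroup (fun a => exists g, f g = a).
Proof.
split; first by exists 0; rewrite raddf0.
by move=> _ _ [g <-] [g' <-]; exists (g - g'); rewrite raddfB.
Qed.

Lemma intersection_is_subgroup (G : zmodType) (S S' : G -> Prop) :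
  is_subgroup S -> is_subgroup S' -> is_subgroup (fun x => S x /\ S' x).
Proof.
move=> hS hS'; split=> [|x y [? ?] [? ?]]; split; try exact: sg0; exact: sgB.
Qed.

Lemma additive_of_morphism (G N : zmodType) (f : G -> N) :
  {morph f : x y / x - y} -> exists F : {additive G -> N}, F =1 f.
Proof.
move=> fB; pose m := GRing.isZmodMorphism.Build G N f fB.
by exists (HB.pack f m : {additive G -> N}).
Qed.

(** Closure under subtraction and a trivial fibre over [0] make the relation single-valued, so any
    choice function for it is additive. *)
Lemma additive_of_relation (G N : zmodType) (R : G -> N -> Prop) :
  (forall x y x' y', R x y -> R x' y' -> R (x - x') (y - y')) ->
  (forall y, R 0 y -> y = 0) -> (forall x, exists y, R x y) ->
  exists f : {additive G -> N}, forall x, R x (f x).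
Proof.
move=> RB R0 /choice[f Rf]; have fB : {morph f : x y / x - y}.
  move=> x y; apply/eqP; rewrite -subr_eq0; apply/eqP/R0.
  have /(RB _ _ _ _ (Rf (x - y))) := RB _ _ _ _ (Rf x) (Rf y).
  by rewrite subrr.
by have [F Ff] := additive_of_morphism fB; exists F => x; rewrite Ff.
Qed.

Section Quotient.
Variables (G : zmodType) (H : zmodClosed G).

Definition quot_map : {additive G -> {ideal_quot H}} := \pi_({ideal_quot H})%qT.

Lemma quot_map_eq0 x : (quot_map x = 0) <-> (x \in H).
Proof.
rewrite -[X in X \in H]subr0 Quotient.idealrBE.
by rewrite -[X in _ = X](raddf0 quot_map); split=> [->|/eqP].
Qed.

Lemma quot_map_surj a : exists x, quot_map x = a.
Proof. by exists (repr a); exact: reprK. Qed.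
End Quotient.

(** A condition on elements that is monotone in the subgroup survives unions of chains, so Zorn's
    lemma applies. *)
Lemma subgroup_zorn (G : zmodType) (P : (G -> Prop) -> G -> Prop)
    (S0 : G -> Prop) :
  is_subgroup S0 ->
  (forall S S' x, (forall y, S y -> S' y) -> P S x -> P S' x) ->
  (forall x, S0 x -> P S0 x) ->
  exists M, [/\ is_subgroup M, forall x, S0 x -> M x, forall x, M x -> P M x &
    forall M', is_subgroup M' -> (forall x, M x -> M' x) ->
      (forall x, M' x -> P M' x) -> forall x, M' x -> M x].
Proof.
move=> hS0 Pmono PS0.
pose good S := [/\ is_subgroup S, forall x, S0 x -> S x & forall x, S x -> P S x].
have good0 : good S0 by [].
pose T := {S : G -> Prop | good S}.
pose R (s t : T) := `[< forall x, sval s x -> sval t x >].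
have [||A Atot|[M [hM SM PM]] Mmax] := @ZL_preorder T (exist _ S0 good0) R.
- by move=> t; apply/asboolP.
- by move=> r s t /asboolP rs /asboolP st; apply/asboolP => x /rs /st.
- have [[s0 As0]|A0] := pselect (exists s, A s); last first.
    by exists (exist _ S0 good0) => s As; case: A0; exists s.
  pose U x := exists2 s, A s & sval s x.
  have gU : good U.
    split.
    + split=> [|x y [s As sx] [t At ty]].
        by exists s0 => //; apply: sg0; case: (svalP s0).
      have [/asboolP st|/asboolP ts] := Atot _ _ As At.
        by exists t => //; apply: sgB => //; [case: (svalP t)|exact: st].
      by exists s => //; apply: sgB => //; [case: (svalP s)|exact: ts].
    + by move=> x S0x; exists s0 => //; case: (svalP s0) => _ + _; apply.
    + move=> x [s As sx]; apply: (Pmono (sval s)); first by move=> y; exists s.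
      by case: (svalP s) => _ _; apply.
  by exists (exist _ U gU) => s As; apply/asboolP => x sx; exists s.
- exists M; split=> // M' hM' MM' PM'.
  have gM' : good M' by split=> // x /SM /MM'.
  by have /asboolP := Mmax (exist _ M' gM') (asboolT MM').
Qed.

Lemma absz_sign (k : int) : (`|k|%N : int) = k \/ (`|k|%N : int) = - k.
Proof. by case: k => n; [left | right; rewrite NegzE opprK]. Qed.

(** The generator is the least positive member; [d = 0] covers the zero subgroup. *)
Lemma subgroup_principal (S : int -> Prop) : is_subgroup S ->
  exists d : nat, S d%:Z /\ forall k : nat, S k%:Z -> (d %| k)%N.
Proof.
move=> hS.
have [ex|nex] := pselect (exists n : nat, `[< S n%:Z >] && (0 < n)%N).
  case: (ex_minnP ex) => d /andP[/asboolP Sd d0] dmin; exists d; split=> // k Sk.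
  rewrite /dvdn; apply: contraT; rewrite -lt0n => r0.
  have Sr : S (k %% d)%N%:Z.
    have -> : (k %% d)%N%:Z = k%:Z - d%:Z *~ (k %/ d)%N.
      by rewrite {2}(divn_eq k d) PoszD PoszM -mulrzr mulrC intz addrAC subrr add0r.
    by apply: sgB => //; exact: sgMz.
  have := dmin (k %% d)%N; rewrite asboolT // r0 => /(_ isT).
  by rewrite leqNgt ltn_pmod.
exists 0%N; split; first exact: (sg0 hS).
move=> k Sk; rewrite dvd0n; apply: contraT; rewrite -lt0n => k0.
by case: nex; exists k; rewrite asboolT.
Qed.

Lemma pairMn (A B : zmodType) (x : A) (y : B) n :
  (x, y) *+ n = (x *+ n, y *+ n).
Proof. by elim: n => [//|n IHn]; rewrite !mulrS IHn. Qed.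

Lemma pairMz (A B : zmodType) (x : A) (y : B) (k : int) :
  (x, y) *~ k = (x *~ k, y *~ k).
Proof. by case: k => n; rewrite /intmul pairMn. Qed.

(** In the second condition, [d] is the generator of the ideal of integers [k]
    such that a given partial extension is defined at [k x], and [w] is its value
    at [d x]. *)
Lemma extend_additive (F G N : zmodType) (alpha : {additive F -> G})
    (beta : {additive F -> N}) :
  (forall u, alpha u = 0 -> beta u = 0) ->
  (forall (x : G) (d : nat) (w : N),
     (forall (k : nat) u, alpha u = x *+ k -> (d %| k)%N) ->
     (forall (k : nat) u, alpha u = x *+ (d * k) -> beta u = w *+ k) ->
     exists y, y *+ d = w) ->
  exists f : {additive G -> N}, forall u, f (alpha u) = beta u.
Proof.
move=> kerP divP.
(* A maximal partial extension: [R] is the graph of a homomorphism on a subgroup of [G] containing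
   the image of [alpha]. *)
have [|//|z [u ->]|R [hR RS Rfun Rmax]] := @subgroup_zorn (G * N)%type
    (fun _ z => z.1 = 0 -> z.2 = 0) (fun z => exists u, z = (alpha u, beta u)).
- split; first by exists 0; rewrite !raddf0.
  by move=> _ _ [u ->] [v ->]; exists (u - v); rewrite !raddfB.
- exact: kerP.
have Rval x w w' : R (x, w) -> R (x, w') -> w = w'.
  move=> Rw /(sgB hR Rw) /Rfun /=; rewrite subrr => /(_ erefl) /eqP.
  by rewrite subr_eq0 => /eqP.
have [|||f Rf] := @additive_of_relation G N (fun x y => R (x, y)).
- by move=> x y x' y' Rxy Rxy'; exact: (sgB hR Rxy Rxy').
- by move=> y Ry; exact: (Rfun _ Ry).
- move=> x.
  pose dom (k : int) := exists w, R (x *~ k, w).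
  have domP : is_subgroup dom.
    split; first by exists 0; exact: (sg0 hR).
    move=> k l [w Rw] [w' Rw']; exists (w - w'); rewrite mulrzBr.
    exact: (sgB hR Rw Rw').
  have [d [[w Rw] dmin]] := subgroup_principal domP.
  have [k u ux|k u ux|y yw] := divP x d w.
  + by apply: dmin; exists (beta u); apply: RS; exists u; rewrite ux.
  + apply: (Rval (alpha u)); first by apply: RS; exists u.
    rewrite ux mulrnA; by rewrite pmulrn -pairMn; exact: (sgMn hR k Rw).
  exists y.
  (* Adjoining [(x, y)] keeps the graph single-valued because [y *+ d = w]; maximality then puts [x]
     in the domain. *)
  pose R' (z : G * N) := exists k : int, R (z.1 - x *~ k, z.2 - y *~ k).
  apply: (Rmax R'); last by exists 1; rewrite /= !subrr; exact: (sg0 hR).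
  + split; first by exists 0; rewrite /= !subrr; exact: (sg0 hR).
    move=> [a1 b1] [a2 b2] [k1 R1] [k2 R2]; exists (k1 - k2).
    have := sgB hR R1 R2; congr (R (_, _)) => /=.
      by rewrite mulrzBr !opprD !opprK addrACA.
    by rewrite mulrzBr !opprD !opprK addrACA.
  + by move=> [a b] Rab; exists 0; rewrite /= !subr0.
  move=> [a b] [k /= Rk] a0; rewrite a0 sub0r in Rk.
  have Rk' : R (x *~ k, y *~ k - b).
    by have := sgN hR Rk; congr (R (_, _)); rewrite /= ?opprK ?opprB.
  have dk : (d%:Z %| k)%Z.
    rewrite dvdzE; apply: dmin.
    have [e|e] := absz_sign k.
      by rewrite /dom e; exists (y *~ k - b).
    rewrite /dom e; exists (- (y *~ k - b)).
    by have := sgN hR Rk'; congr (R (_, _)); rewrite /= mulrNz.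
  case/dvdzP: dk => j kE; rewrite kE mulrC mulrzA in Rk'.
  have := sgMz hR j Rw; rewrite pairMz => /(Rval _ _ _ Rk').
  rewrite -yw mulrzA pmulrn => /eqP; rewrite -subr_eq0 addrAC subrr add0r oppr_eq0.
  by move/eqP.
by exists f => u; apply: (Rval (alpha u)) => //; apply: RS; exists u.
Qed.

(** * Images in direct summands *)

(** By Bezout. The usual case is [m = p] with [x *~ p] in [S]: one multiple of [x] in [S] with
    coefficient prime to [p] is then enough. *)
Lemma sg_coprime (G : zmodType) (S : G -> Prop) (x : G) (m n : int) :
  is_subgroup S -> coprimez m n -> S (x *~ m) -> S (x *~ n) -> S x.
Proof.
move=> hS /coprimezP[[u v] /= uv] Sm Sn.
rewrite -[x]mulr1z -uv mulrzDr mulrC [v * _]mulrC !mulrzA.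
by apply: (sgD hS); exact: (sgMz hS).
Qed.

Lemma zero_is_subgroup (G : zmodType) : is_subgroup (fun x : G => x = 0).
Proof. by split=> // x y -> ->; rewrite subrr. Qed.

Lemma setT_is_subgroup (G : zmodType) : is_subgroup (fun _ : G => True).
Proof. by []. Qed.

Lemma coprime_torsion_eq0 (G : zmodType) (x : G) (m n : nat) :
  coprime m n -> x *+ m = 0 -> x *+ n = 0 -> x = 0.
Proof.
by move=> mn xm xn; apply: (@sg_coprime G _ x m n (zero_is_subgroup G)).
Qed.

Lemma coprime_torsion_div (G : zmodType) (x : G) (m n : nat) :
  coprime m n -> x *+ m = 0 -> exists u : int, (x *~ u) *+ n = x.
Proof.
move=> mn xm; have /coprimezP[[u v] /= uv] : coprimez m n by [].
exists v; rewrite pmulrn -mulrzA -[RHS]mulr1z -uv mulrzDr.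
by rewrite [u * _]mulrC (mulrzA x m) -(pmulrn x m) xm mul0rz add0r.
Qed.

Lemma ndvdz_coprime (p : nat) (k : int) :
  prime p -> ~~ (p%:Z %| k)%Z -> coprimez p%:Z k.
Proof. by move=> pp; rewrite dvdzE coprimezE /= prime_coprime. Qed.

Section ElementaryComplement.
Variables (G : zmodType) (p : nat) (pp : prime p).

(** [C/X] is a vector space over the field with [p] elements, and [C'/X] is a complement of the
    image of [S] in it, found as a maximal subgroup over [X] meeting [S] inside [X]. *)
Lemma elementary_complement (C X S : G -> Prop) :
  is_subgroup C -> is_subgroup X -> is_subgroup S ->
  (forall x, C x -> X (x *+ p)) -> (forall x, X x -> C x) ->
  (forall x, S x -> C x) ->
  exists C', [/\ is_subgroup C', forall x, X x -> C' x, forall x, C' x -> C x,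
    forall x, C x -> exists c s, [/\ C' c, S s & x = c + s] &
    forall x, C' x -> S x -> X x].
Proof.
move=> hC hX hS pC XC SC.
have [//|x Xx|M [hM XM PM] Mmax] := @subgroup_zorn G
  (fun _ x => C x /\ (S x -> X x)) X hX.
  by split=> //; exact: XC.
exists M; split=> // [x /PM[]//|x Cx|x /PM[]//].
apply: contrapT => nx.
pose M' y := exists k : int, M (y - x *~ k).
have hM' : is_subgroup M'.
  split; first by exists 0; rewrite subrr; exact: (sg0 hM).
  move=> a b [k Mk] [l Ml]; exists (k - l).
  have := sgB hM Mk Ml; congr (M _).
  by rewrite mulrzBr !opprD !opprK addrACA.
have : M x.
  apply: (Mmax M') => //; first by move=> y My; exists 0; rewrite subr0.
  - move=> y [k Mk]; split.
      rewrite -[y](subrK (x *~ k)); apply: (sgD hC); last exact: (sgMz hC).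
      by case: (PM _ Mk).
    move=> Sy; have [/dvdzP[j kE]|] := boolP (p%:Z %| k)%Z.
      have Mxk : M (x *~ k).
        by rewrite kE mulrC mulrzA; apply: (sgMz hM); apply: XM; exact: pC.
      have My : M y by rewrite -[y](subrK (x *~ k)); exact: (sgD hM).
      by have [_] := PM _ My; apply.
    (* Here [x *~ k = y - (y - x *~ k)] lies in [W], the sum of [M] and [S], and so does [x *~ p];
       hence so does [x]. *)
    move=> /(ndvdz_coprime pp) pk; case: nx.
    pose W z := exists c s, [/\ M c, S s & z = c + s].
    have hW : is_subgroup W.
      split; first by exists 0, 0; split; rewrite ?addr0 //; exact: sg0.
      move=> _ _ [c [s [Mc Ss ->]]] [c' [s' [Mc' Ss' ->]]].
      exists (c - c'), (s - s'); split; [exact: sgB|exact: sgB|].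
      by rewrite opprD addrACA.
    apply: (@sg_coprime G W x _ _ hW pk).
      exists (x *~ p%:Z), 0; split; rewrite ?addr0 //; last exact: sg0.
      by apply: XM; exact: pC.
    exists (- (y - x *~ k)), y; split=> //; first exact: (sgN hM).
    by rewrite opprB subrK.
  - by exists 1; rewrite subrr; exact: (sg0 hM).
move=> Mx; apply: nx; exists x, 0; split; rewrite ?addr0 //; exact: sg0.
Qed.

Lemma multiples_is_subgroup (x : G) :
  is_subgroup (fun y => exists k : int, y = x *~ k).
Proof.
split; first by exists 0.
by move=> _ _ [k ->] [l ->]; exists (k - l); rewrite mulrzBr.
Qed.

(** [G/Y] is elementary, so the class of [x] spans a direct summand; [f] is the coordinate along it,
    multiplied by [s]. *)
Lemma cyclic_functional (N : zmodType) (Y : G -> Prop) (x : G) (s : N) :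
  is_subgroup Y -> (forall g, Y (g *+ p)) -> ~ Y x -> s *+ p = 0 ->
  exists f : {additive G -> N}, [/\ forall y, Y y -> f y = 0, f x = s &
    forall g, exists k : int, f g = s *~ k].
Proof.
move=> hY pG nYx ps.
have [x' _|//|//|C [hC YC _ CS CY]] := @elementary_complement (fun _ => True) Y _
  (setT_is_subgroup G) hY (multiples_is_subgroup x).
  exact: pG.
pose R g w := exists c (k : int), [/\ C c, g = c + x *~ k & w = s *~ k].
have R0 w : R 0 w -> w = 0.
  move=> [c [k [Cc /eqP]]]; rewrite eq_sym addr_eq0 => /eqP cE ->.
  have Yk : Y (x *~ k).
    apply: CY; last by exists k.
    by rewrite -[_ *~ _]opprK -cE; exact: (sgN hC).
  have [/dvdzP[j ->]|/(ndvdz_coprime pp) pk] := boolP (p%:Z %| k)%Z.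
    by rewrite mulrC mulrzA -pmulrn ps mul0rz.
  by case: nYx; apply: (@sg_coprime G Y x _ _ hY pk) => //; exact: pG.
have RB a b a' b' : R a b -> R a' b' -> R (a - a') (b - b').
  move=> [c [k [Cc -> ->]]] [c' [k' [Cc' -> ->]]]; exists (c - c'), (k - k').
  by split; rewrite ?mulrzBr // ?opprD 1?addrACA //; exact: (sgB hC).
have [|f Rf] := additive_of_relation RB R0.
  move=> g; have [c [_ [Cc [k ->] ->]]] := CS g I.
  by exists (s *~ k), c, k.
have fE a b : R a b -> f a = b.
  move=> Rab; apply/eqP; rewrite -subr_eq0; apply/eqP/R0.
  by have := RB _ _ _ _ (Rf a) Rab; rewrite subrr.
exists f; split.
- by move=> y Yy; apply: fE; exists y, 0; split; rewrite ?addr0 //; exact: YC.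
- by apply: fE; exists 0, 1; split; rewrite ?add0r //; exact: sg0.
- by move=> g; have [c [k [_ _ ->]]] := Rf g; exists k.
Qed.
End ElementaryComplement.

Lemma complement_projection (A : zmodType) (K L : A -> Prop) :
  is_subgroup K -> is_subgroup L -> (forall x, K x -> L x -> x = 0) ->
  (forall x, exists y z, [/\ K y, L z & x = y + z]) ->
  exists r : {additive A -> A}, [/\ forall x, K (r x), forall x, L (x - r x),
    forall x, K x -> r x = x & forall x, L x -> r x = 0].
Proof.
move=> hK hL KL0 KL.
pose R x y := K y /\ L (x - y).
have R0 y : R 0 y -> y = 0.
  by case=> Ky; rewrite sub0r => /(sgN hL); rewrite opprK; exact: KL0.
have RB a b a' b' : R a b -> R a' b' -> R (a - a') (b - b').
  move=> [Kb Lb] [Kb' Lb']; split; first exact: (sgB hK).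
  by have := sgB hL Lb Lb'; rewrite !opprD !opprK addrACA.
have [|r Rr] := additive_of_relation RB R0.
  by move=> x; have [y [z [Ky Lz ->]]] := KL x; exists y; split; rewrite // addrAC subrr add0r.
have rE a b : R a b -> r a = b.
  move=> Rab; apply/eqP; rewrite -subr_eq0; apply/eqP/R0.
  by have := RB _ _ _ _ (Rr a) Rab; rewrite subrr.
exists r; split.
- by move=> x; case: (Rr x).
- by move=> x; case: (Rr x).
- by move=> x Kx; apply: rE; split; rewrite ?subrr //; exact: sg0.
- by move=> x Lx; apply: rE; split; rewrite ?subr0 //; exact: sg0.
Qed.

(** The summand is encoded as the image of an idempotent [r], and essentiality is tested on cyclic
    subgroups, which suffices. *)
Definition essential_in_retract (G A : zmodType) (phi : {additive G -> A}) :=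
  exists r : {additive A -> A}, [/\ forall a, r (r a) = r a,
    forall g, r (phi g) = phi g &
    forall y, r y = y -> y != 0 ->
      exists (k : int) g, phi g = y *~ k /\ y *~ k != 0].

Lemma essential_in_retractP (G A : zmodType) (phi : {additive G -> A}) :
  (exists2 K : zmodClosed A,
     direct_summand K & essential_in (image_subgroup phi) K) <->
  essential_in_retract phi.
Proof.
split.
  move=> [K [L [KL0 KL]] [phiK ess]].
  have [//|//|r [rK rL r1 _]] := complement_projection
    (closed_is_subgroup K) (closed_is_subgroup L).
  exists r; split.
  - by move=> a; apply: r1; exact: rK.
  - by move=> g; apply: r1; apply: phiK; apply/asboolP; exists g.
  - move=> y ry y0.
    have [S SE] := sg_zmodClosed (multiples_is_subgroup y).
    have [||z [zphi /SE[k zk] z0]] := ess S.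
    + move=> _ /SE[k ->]; apply: (sgMz (closed_is_subgroup K)).
      by rewrite -ry; exact: rK.
    + by exists y => //; apply/SE; exists 1.
    + by move: zphi => /asboolP[g gz]; exists k, g; rewrite gz -zk.
move=> [r [rr rphi ess]].
have hK : is_subgroup (fun y => r y = y).
  by split=> [|x y rx ry]; rewrite ?raddf0 // raddfB rx ry.
have hL : is_subgroup (fun y => r y = 0).
  by split=> [|x y rx ry]; rewrite ?raddf0 // raddfB rx ry subrr.
have [K KE] := sg_zmodClosed hK; have [L LE] := sg_zmodClosed hL.
exists K.
  exists L; split=> [x /KE rx /LE|x]; first by rewrite rx.
  exists (r x), (x - r x); split.
  - by apply/KE.
  - by apply/LE; rewrite raddfB rr subrr.
  - by rewrite addrC subrK.
split=> [_ /asboolP[g <-]|S SK [x xS x0]]; first exact/KE.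
have [||k [g [phig xk]]] := ess x; [exact/KE/SK|by []|].
exists (x *~ k); split=> //; first by apply/asboolP; exists g.
by apply: (sgMz (closed_is_subgroup S)).
Qed.

(** The first isomorphism theorem for [q]. *)
Lemma surjection_section (G A : zmodType) (q : {additive G -> A}) (H : zmodClosed G) :
  (forall x, x \in H <-> q x = 0) -> (forall a, exists g, q g = a) ->
  exists (j : {additive {ideal_quot H} -> A}) (i : {additive A -> {ideal_quot H}}),
    [/\ forall g, j (quot_map H g) = q g, cancel i j & cancel j i].
Proof.
move=> HE qsurj.
pose R (b : {ideal_quot H}) a := exists g, b = quot_map H g /\ a = q g.
pose R' a (b : {ideal_quot H}) := R b a.
have RB a b a' b' : R a b -> R a' b' -> R (a - a') (b - b').
  by move=> [g [-> ->]] [g' [-> ->]]; exists (g - g'); rewrite !raddfB.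
have R0 y : R 0 y -> y = 0.
  by move=> [g [/esym/quot_map_eq0 /HE <- ->]].
have R0' y : R' 0 y -> y = 0.
  by move=> [g [-> /esym /HE /quot_map_eq0]].
have [|j Rj] := additive_of_relation RB R0.
  by move=> b; have [g <-] := quot_map_surj b; exists (q g), g.
have [||i Ri] := @additive_of_relation _ _ R' _ R0'.
- by move=> a b a' b'; exact: RB.
- by move=> a; have [g <-] := qsurj a; exists (quot_map H g), g.
have jE b a : R b a -> j b = a.
  move=> Rab; apply/eqP; rewrite -subr_eq0; apply/eqP/R0.
  by have := RB _ _ _ _ (Rj b) Rab; rewrite subrr.
have iE b a : R b a -> i a = b.
  move=> Rab; apply/eqP; rewrite -subr_eq0; apply/eqP/R0'.
  by have := RB _ _ _ _ (Ri a) Rab; rewrite subrr.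
exists j, i; split.
- by move=> g; apply: jE; exists g.
- by move=> a; apply: jE; exact: Ri.
- by move=> b; apply: iE; exact: Rj.
Qed.

Lemma kernel_is_subgroup (G A : zmodType) (q : {additive G -> A}) :
  is_subgroup (fun x => q x = 0).
Proof. by split=> [|x y qx qy]; rewrite ?raddf0 // raddfB qx qy subrr. Qed.

(** The defining property transported along the isomorphism of [G/ker q] with [A]. *)
Lemma co_Bassian_onto (G A : zmodType) (q phi : {additive G -> A}) :
  semi_generalized_co_Bassian G -> (forall a, exists g, q g = a) ->
  (forall g, phi g = 0 -> g = 0) -> essential_in_retract phi.
Proof.
move=> coG qsurj phi_inj.
have [H HE] := sg_zmodClosed (kernel_is_subgroup q).
have [j [i [jq ij ji]]] := surjection_section HE qsurj.
pose psi : {additive G -> {ideal_quot H}} := i \o phi.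
have [|r [rr rpsi ess]] := (essential_in_retractP psi).1 (coG H psi _).
  apply: raddf_inj => g /(congr1 j); rewrite /= ij raddf0; exact: phi_inj.
exists (j \o (r \o i)); split=> /=.
- by move=> a; rewrite ji rr.
- by move=> g; rewrite rpsi /= ij.
- move=> y /(congr1 i); rewrite ji => ry y0.
  have [|k [g [gE yk]]] := ess _ ry.
    by apply: contra y0 => /eqP /(congr1 j); rewrite ij raddf0 => /eqP.
  exists k, g; split.
    by move: gE => /= /(congr1 j); rewrite raddfMz !ij.
  by apply: contra yk => /eqP e; rewrite -raddfMz e raddf0.
Qed.

(** [r (phi x) = phi x] for the retraction [r] onto the summand, so
    [phi x - p^b r a] is an element of the summand killed by [p], hence it lies
    in the image of [phi]. *)
Lemma co_Bassian_height (G A : zmodType) (q phi : {additive G -> A})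
    (p b : nat) (x : G) (a : A) :
  semi_generalized_co_Bassian G -> (forall a, exists g, q g = a) ->
  (forall g, phi g = 0 -> g = 0) -> prime p ->
  phi x *+ p = a *+ (p ^ b.+1) ->
  exists t a', t *+ p = 0 /\ phi (x - t) = a' *+ (p ^ b).
Proof.
move=> coG qsurj phi_inj pp xa.
have [r [rr rphi ess]] := co_Bassian_onto coG qsurj phi_inj.
pose y := phi x - r a *+ (p ^ b).
have ry : r y = y by rewrite raddfB raddfMn rr rphi.
have py : y *+ p = 0.
  by rewrite mulrnBl -mulrnA -expnSr -(raddfMn r (p ^ b.+1)) -xa raddfMn rphi subrr.
have [y0|y0] := eqVneq y 0.
  exists 0, (r a); rewrite mul0rn subr0; split=> //.
  by apply/eqP; rewrite -subr_eq0; apply/eqP.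
have [k [g [gE yk]]] := ess y ry y0.
have [/dvdzP[j kE]|/(ndvdz_coprime pp) pk] := boolP (p%:Z %| k)%Z.
  by case/eqP: yk; rewrite kE mulrC mulrzA -pmulrn py mul0rz.
have [t tE] : exists t, phi t = y.
  pose S z := exists t, phi t = z.
  have hS : is_subgroup S := image_is_subgroup _.
  apply: (@sg_coprime A S y _ _ hS pk); last by exists g.
  by exists 0; rewrite raddf0 -pmulrn py.
exists t, (r a); split.
  by apply: phi_inj; rewrite raddfMn tE.
by rewrite raddfB tE /y opprB addrC subrK.
Qed.

Lemma additive_pair (G A B : zmodType) (f : {additive G -> A}) (g : {additive G -> B}) :
  exists h : {additive G -> (A * B)%type}, forall x, h x = (f x, g x).
Proof.
have [h hE] : exists h : {additive G -> (A * B)%type}, h =1 (fun x => (f x, g x)).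
  by apply: additive_of_morphism => x y; rewrite !raddfB.
by exists h.
Qed.

(** The quotient map and [phi], both [M -> M/H], extend to maps [G -> M/H x G/M] with the quotient
    map by [M] as second component. The retraction obtained there fixes [0 x G/M], so it induces one
    on [M/H]. *)
Lemma co_Bassian_retract (G : zmodType) (M : zmodClosed G) (r : {additive G -> G}) :
  (forall x, r x \in M) -> (forall x, x \in M -> r x = x) ->
  semi_generalized_co_Bassian G -> semi_generalized_co_Bassian (subgroup M).
Proof.
move=> rM r1 coG H phi phi_inj; apply/essential_in_retractP.
have [rs rsE] : exists rs : {additive G -> subgroup M}, forall x, val (rs x) = r x.
  have [rs rsE] : exists rs : {additive G -> subgroup M},
      rs =1 (fun x => Sub (r x) (rM x)).
    by apply: additive_of_morphism => x y; apply: val_inj; rewrite /= raddfB.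
  by exists rs => x; rewrite rsE.
have rs_val m : rs (val m) = m by apply: val_inj; rewrite rsE r1 //; exact: valP.
have [q qE] := additive_pair (quot_map H \o rs) (quot_map M).
have [psi psiE] := additive_pair (phi \o rs) (quot_map M).
have r_idem g : r (g - r g) = 0 by rewrite raddfB [r (r g)]r1 ?subrr.
have rs_idem g : rs (g - r g) = 0 by apply: val_inj; rewrite rsE r_idem.
have quot_r g : quot_map M (r g) = 0 by apply/quot_map_eq0.
have [|g|s [ss spsi ess]] := @co_Bassian_onto G _ q psi coG.
- move=> [a b]; have [m <-] := quot_map_surj a; have [g <-] := quot_map_surj b.
  exists (val m + (g - r g)); rewrite qE /= raddfD /= rs_val rs_idem addr0.
  congr (_, _); rewrite raddfD raddfB quot_r subr0.
  have /quot_map_eq0 -> : val m \in M by exact: valP.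
  by rewrite add0r.
- rewrite psiE => -[/eqP]; rewrite -(raddf0 phi) (inj_eq phi_inj) => /eqP rs0.
  by move=> /quot_map_eq0 /r1 <-; rewrite -rsE rs0.
(* [psi] maps [g - r g] to [(0, n)], and [s] fixes the image of [psi]. *)
have s0 n : s (0, n) = (0, n).
  have [g <-] := quot_map_surj n.
  have := spsi (g - r g); rewrite psiE /= rs_idem raddf0.
  by rewrite raddfB quot_r subr0.
pose f a := (s (a, 0)).1.
have [F FE] : exists F : {additive {ideal_quot H} -> {ideal_quot H}}, F =1 f.
  apply: additive_of_morphism => x y; rewrite /f.
  have -> : (x - y, 0) = (x, 0) - (y, 0) :> {ideal_quot H} * {ideal_quot M}.
    by congr (_, _); rewrite subrr.
  by rewrite raddfB.
have split_pair (a : {ideal_quot H}) (n : {ideal_quot M}) : s (a, 0) = s (a, n) - (0, n).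
  by rewrite -s0 -raddfB; congr (s (_, _)); rewrite ?subr0 ?subrr.
exists F; split.
- move=> a; rewrite !FE /f (split_pair (s (a, 0)).1 (s (a, 0)).2).
  by rewrite -surjective_pairing ss /= subr0.
- move=> m; rewrite FE /f; have := spsi (val m); rewrite psiE /= rs_val.
  have /quot_map_eq0 -> : val m \in M by exact: valP.
  by move=> ->.
- move=> y; rewrite FE /f => sy y0.
  have sy0 : s (y, 0) = (y, 0).
    rewrite (split_pair y (s (y, 0)).2) -{1}sy -surjective_pairing ss.
    by rewrite {1}[s _]surjective_pairing sy; congr (_, _); rewrite ?subr0 ?subrr.
  have [|k [g []]] := ess _ sy0.
    by apply: contra y0 => /eqP[->].
  rewrite pairMz mul0rz psiE => -[gE _] yk; exists k, (rs g); split=> //.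
  by apply: contra yk => /eqP ->.
Qed.

(** * The p-component as a direct summand *)

(** Baer: divisible groups are injective. In the case [d = 0] the value [w] is the value at [0],
    hence [0]. *)
Lemma divisible_extension (F G N : zmodType) (alpha : {additive F -> G})
    (beta : {additive F -> N}) :
  divisible N -> (forall u, alpha u = 0 -> beta u = 0) ->
  exists f : {additive G -> N}, forall u, f (alpha u) = beta u.
Proof.
move=> divN kerP; apply: extend_additive => // x [|d] w _ dw; last exact: divN.
have <- : 0 = w by have := dw 1%N 0; rewrite !raddf0; exact.
by exists 0; rewrite mul0rn.
Qed.

(** A bounded [p]-group in which every element has the largest height allowed
    by its order is injective relative to [G / p^m G]. *)
Lemma bounded_extension (F G N : zmodType) (p m : nat)
    (alpha : {additive F -> G}) (beta : {additive F -> N}) :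
  prime p ->
  (forall j w, (j <= m)%N -> w *+ (p ^ (m - j)) = 0 ->
     exists y : N, y *+ (p ^ j) = w) ->
  (forall u g, alpha u = g *+ (p ^ m) -> beta u = 0) ->
  exists f : {additive G -> N}, forall u, f (alpha u) = beta u.
Proof.
move=> pp divN kerP.
(* The extra summand [G] puts [x *+ (p ^ m)] in the domain for every [x], so the generator [d] is a
   power of [p]; [kerP] lets [beta] be extended by [0] to it. *)
have [a aE] : exists a : {additive (F * G)%type -> G},
    a =1 (fun z => alpha z.1 + z.2 *+ (p ^ m)).
  by apply: additive_of_morphism => x y; rewrite raddfB mulrnBl opprD addrACA.
have [b bE] : exists b : {additive (F * G)%type -> N}, b =1 (fun z => beta z.1).
  by apply: additive_of_morphism => x y; rewrite raddfB.
have [u|x d w dk dw|f fE] := @extend_additive _ _ _ a b.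
- rewrite aE bE => /eqP; rewrite addr_eq0 -mulNrn => /eqP; exact: kerP.
- have /(dvdn_pfactor _ _ pp)[j jm dE] : (d %| p ^ m)%N.
    by apply: (dk _ (0, x)); rewrite aE /= raddf0 add0r.
  subst d; apply: divN => //.
  have := dw (p ^ (m - j))%N (0, x); rewrite aE bE /= !raddf0 add0r.
  by rewrite -expnD subnKC // => /(_ erefl).
- exists f => u; have := fE (u, 0).
  by rewrite aE bE /= mul0rn addr0.
Qed.

Lemma pgroup_coprime_div (N : zmodType) (p n k : nat) (x : N) :
  prime p -> ~~ (p %| n)%N -> x *+ (p ^ k) = 0 -> exists u : int, (x *~ u) *+ n = x.
Proof.
move=> pp pn; apply: coprime_torsion_div; apply: coprimeXl.
by rewrite prime_coprime.
Qed.

Lemma prime_part (p n : nat) : prime p -> (0 < n)%N ->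
  exists e m, ~~ (p %| m)%N /\ n = (p ^ e * m)%N.
Proof.
move=> pp n0; have [||m pm nE] := @pfactor_coprime p n => //.
exists (logn p n), m; split; first by rewrite -prime_coprime.
by rewrite mulnC.
Qed.

Lemma pgroup_divisible (N : zmodType) (p : nat) : prime p ->
  (forall x : N, exists k, x *+ (p ^ k) = 0) ->
  (forall x : N, exists y, y *+ p = x) -> divisible N.
Proof.
move=> pp pN divN n n0 x.
have divpow e z : exists y : N, y *+ (p ^ e) = z.
  elim: e z => [|e IHe] z; first by exists z.
  have [y <-] := divN z; have [y' <-] := IHe y.
  by exists y'; rewrite -mulrnA expnSr.
have [e [m [pm ->]]] := prime_part pp n0.
have [y yx] := divpow e x; have [k yk] := pN y.
have [u uy] := pgroup_coprime_div pp pm yk.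
by exists (y *~ u); rewrite mulnC mulrnA uy.
Qed.

Lemma in_pcomponent (G : zmodType) (p : nat) (x : G) :
  x \in pcomponent_subgroup G p <-> exists k, x *+ (p ^ k) = 0.
Proof. by split=> /asboolP. Qed.

Lemma subgroup_lift (G : zmodType) (H : zmodClosed G) (x : G) :
  x \in H -> exists u : subgroup H, val u = x.
Proof. by move=> xH; exists (exist (fun y => y \in H) x xH). Qed.

Section PComponent.
Variables (G : zmodType) (p : nat) (pp : prime p).
Local Notation T := (pcomponent_subgroup G p).

Lemma pcomponent_div x : x *+ p \in T -> x \in T.
Proof.
move=> /in_pcomponent[k xk]; apply/in_pcomponent; exists k.+1.
by rewrite expnS mulrnA.
Qed.

Lemma pcomponent_divX x e : x *+ (p ^ e) \in T -> x \in T.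
Proof.
elim: e x => [|e IHe] x //; rewrite expnSr mulrnA => /pcomponent_div; exact: IHe.
Qed.

Lemma socle_pcomponent x : x *+ p = 0 -> x \in T.
Proof. by move=> px; apply/in_pcomponent; exists 1%N. Qed.

(** That is, [p^n T_p = p^(n+1) T_p]; for a prime [p] this says that [p^n T_p] is divisible. *)
Definition stable_height (n : nat) :=
  forall x, x \in T -> exists2 y, y \in T & x *+ (p ^ n) = y *+ (p ^ n.+1).

Lemma divisible_part (n : nat) : stable_height n ->
  exists D : zmodClosed G, [/\ divisible (subgroup D),
    forall x, x \in D -> exists2 y, y \in T & x = y *+ (p ^ n) &
    forall y, y \in T -> y *+ (p ^ n) \in D].
Proof.
move=> hn; have [|D DE] := @sg_zmodClosed G
    (fun x => exists2 y, y \in T & x = y *+ (p ^ n)).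
  split; first by exists 0; rewrite ?mul0rn ?rpred0.
  move=> _ _ [x xT ->] [y yT ->]; exists (x - y); rewrite ?mulrnBl //.
  exact: rpredB.
exists D; split.
- apply: (@pgroup_divisible _ p) => // x.
    have /DE[y /in_pcomponent[k yk] xy] := valP x.
    exists k; apply: val_inj; rewrite raddfMn /= /val /= in xy *.
    by rewrite xy mulrnAC yk mul0rn.
  have /DE[y yT xy] := valP x; have [z zT yz] := hn y yT.
  have zD : z *+ (p ^ n) \in D by apply/DE; exists z.
  have [u uz] := subgroup_lift zD; exists u; apply: val_inj; rewrite raddfMn /= uz.
  by rewrite -mulrnA -expnSr -yz -xy.
- by move=> x /DE.
- by move=> y yT; apply/DE; exists y.
Qed.

(** With [D = p^n T_p], subgroups [C] over [D] with [C + T_p = G] and [C] meeting [T_p] inside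
    [p^k T_p] are found by induction on [k]. For [k = n] the intersection is inside [D], which
    splits off because it is divisible. *)
Lemma pcomponent_complement (n : nat) : stable_height n ->
  exists C : G -> Prop, [/\ is_subgroup C, forall x, C x -> x \in T -> x = 0 &
    forall x, exists c t, [/\ C c, t \in T & x = c + t]].
Proof.
move=> hn; have [D [divD DT TD]] := divisible_part hn.
have hT := closed_is_subgroup T; have hD := closed_is_subgroup D.
have DsubT x : x \in D -> x \in T.
  by move=> /DT[y yT ->]; exact: rpredMn.
have [C [hC DC CT CTk]] : exists C : G -> Prop, [/\ is_subgroup C,
    forall x, x \in D -> C x,
    forall x, exists c t, [/\ C c, t \in T & x = c + t] &
    forall x, C x -> x \in T -> exists2 y, y \in T & x = y *+ (p ^ n)].
  elim: (n) => [|k [C [hC DC CT CTk]]].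
    exists (fun _ => True); split=> // [x|x _ xT]; last by exists x.
    by exists x, 0; split; rewrite ?addr0 ?rpred0.
  pose X x := exists2 c, C c & x = c *+ p.
  have hX : is_subgroup X.
    split; first by exists 0; rewrite ?mul0rn //; exact: sg0.
    move=> _ _ [x Cx ->] [y Cy ->]; exists (x - y); rewrite ?mulrnBl //.
    exact: sgB.
  have hS := intersection_is_subgroup hC hT.
  (* [C'] is a complement modulo [p C] of the torsion part of [C]: an element of [C'] in [T_p] is
     [c *+ p] with [c] in [C] and in [T_p], which gains one factor [p]. *)
  have [|_ [y Cy ->]|x []//|C' [hC' XC' C'C C'S C'X]] :=
    elementary_complement pp hC hX hS.
  - by move=> x Cx; exists x.
  - exact: (sgMn hC).
  exists C'; split=> //.
  - move=> x xD; apply: XC'.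
    have [u ux] := subgroup_lift xD.
    have [y /(congr1 val)] := divD p (prime_gt0 pp) u.
    rewrite raddfMn /= ux => yx; exists (val y) => //; apply: DC; exact: valP.
  - move=> x; have [c [t [Cc tT ->]]] := CT x.
    have [c' [s [C'c' [_ sT] ->]]] := C'S c Cc.
    by exists c', (s + t); split; rewrite ?addrA ?rpredD.
  - move=> x C'x xT; have Cx := C'C x C'x.
    have [//|c Cc xE] := C'X x C'x.
    have [|y yT cE] := CTk c Cc; first by apply: pcomponent_div; rewrite -xE.
    by exists y; rewrite // xE cE -mulrnA expnSr.
have [u u0|r rE] := @divisible_extension _ _ _
    (val : {additive subgroup D -> G}) (idfun : {additive subgroup D -> subgroup D})
    divD.
  exact: val_inj.
have rD x : x \in D -> val (r x) = x by move=> xD; have [u <-] := subgroup_lift xD; rewrite rE.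
exists (fun x => C x /\ val (r x) = 0); split.
- apply: intersection_is_subgroup => //.
  split=> [|x y rx ry]; first by rewrite raddf0.
  by rewrite raddfB /= rx ry subrr.
- move=> x [Cx rx] xT; have [y yT xy] := CTk x Cx xT.
  by rewrite -[x]rD // xy; exact: TD.
- move=> x; have [c [t [Cc tT ->]]] := CT x.
  have rcD : val (r c) \in D by exact: valP.
  exists (c - val (r c)), (val (r c) + t); split.
  + split; first by apply: (sgB hC) => //; exact: DC.
    by rewrite raddfB /= (rD _ rcD) subrr.
  + by rewrite rpredD // DsubT.
  + by rewrite addrA subrK.
Qed.

Lemma pcomponent_retract (n : nat) : stable_height n ->
  exists r : {additive G -> G},
    (forall x, r x \in T) /\ (forall x, x \in T -> r x = x).
Proof.
move=> hn; have [C [hC CT0 CT]] := pcomponent_complement hn.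
have [||r [rT _ r1 _]] := complement_projection (closed_is_subgroup T) hC.
- by move=> x xT Cx; exact: CT0.
- by move=> x; have [c [t [? ? ->]]] := CT x; exists t, c; rewrite addrC.
by exists r.
Qed.
End PComponent.

(** * Boundedness of the heights *)

Section PolyComb.
Variables (V : zmodType) (v : nat -> V).

(** [{poly int}] serves as the free abelian group on countably many
    generators. *)
Definition poly_comb (P : {poly int}) : V := \sum_(i < size P) v i *~ P`_i.

Lemma poly_combE n (P : {poly int}) : (size P <= n)%N ->
  poly_comb P = \sum_(i < n) v i *~ P`_i.
Proof.
move=> le; rewrite /poly_comb (big_ord_widen _ (fun i => v i *~ P`_i) le).
rewrite big_mkcond; apply: eq_bigr => i _; case: ltnP => // ge.
by rewrite nth_default // mulr0z.
Qed.

Lemma poly_comb_is_zmod_morphism : {morph poly_comb : P Q / P - Q}.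
Proof.
move=> P Q; pose n := maxn (size (P - Q)) (maxn (size P) (size Q)).
rewrite !(@poly_combE n) ?leq_max ?leqnn ?orbT // -sumrB.
by apply: eq_bigr => i _; rewrite coefB mulrzBr.
Qed.

HB.instance Definition _ := GRing.isZmodMorphism.Build {poly int} V poly_comb
  poly_comb_is_zmod_morphism.

Lemma poly_comb1 : poly_comb 1 = v 0%N.
Proof. by rewrite (@poly_combE 1) ?size_poly1 // big_ord1 coef1. Qed.
End PolyComb.

Lemma sg_sum (G : zmodType) (S : G -> Prop) (I : finType) (Q : pred I)
    (F : I -> G) :
  is_subgroup S -> (forall i, Q i -> S (F i)) -> S (\sum_(i | Q i) F i).
Proof. by move=> hS SF; apply: big_ind => //; [exact: sg0 | move=> x y; exact: sgD]. Qed.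

Lemma multiples_of_is_subgroup (G : zmodType) (n : nat) :
  is_subgroup (fun x : G => exists g, x = g *+ n).
Proof.
split; first by exists 0; rewrite mul0rn.
by move=> _ _ [g ->] [g' ->]; exists (g - g'); rewrite mulrnBl.
Qed.

Lemma coefMnz (P : {poly int}) n i : (P *+ n)`_i = P`_i * n%:Z.
Proof. by rewrite coefMn -mulr_natr natz. Qed.

(** * Direct sums of cyclic groups of increasing orders *)

Section Independence.
Variables (G : zmodType) (p : nat) (pp : prime p) (c : nat -> G) (h : nat -> nat).
Hypothesis h_incr : forall i j, (i < j)%N -> (h i < h j)%N.
Hypothesis c_order : forall i, c i *+ (p ^ (h i).+1) = 0.
Hypothesis c_height : forall i g, c i *+ (p ^ h i) <> g *+ (p ^ (h i).+1).

(** The socle elements have distinct heights. At the least index with a coefficient prime to [p],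
    the earlier terms vanish and the later ones lie in [p^(h i + 1) G], against [c_height]. *)
Lemma socle_independent (P : {poly int}) :
  poly_comb (fun i => c i *+ (p ^ h i)) P = 0 -> forall i, (p%:Z %| P`_i)%Z.
Proof.
move=> P0 i; elim/ltn_ind: i => i IHi.
have [ge|lt] := leqP (size P) i; first by rewrite nth_default // dvdz0.
apply: contraT => /(ndvdz_coprime pp) pPi.
have hS := multiples_of_is_subgroup G (p ^ (h i).+1).
have [] := @sg_coprime G _ (c i *+ (p ^ h i)) _ _ hS pPi.
- exists 0; rewrite mul0rn -pmulrn -mulrnA -expnSr; exact: c_order.
- move: P0; rewrite /poly_comb (bigD1 (Ordinal lt)) //= => /eqP.
  rewrite addr_eq0 => /eqP ->; apply: (sgN hS); apply: (sg_sum hS) => j ji.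
  have [lt_ij|lt_ji|eq_ij] := ltngtP i j.
  + apply: (sgMz hS); exists (c j *+ (p ^ (h j - (h i).+1))).
    by rewrite -mulrnA -expnD subnK // h_incr.
  + have /dvdzP[k ->] := IHi j lt_ji; exists 0.
    by rewrite mulrC mulrzA -pmulrn -mulrnA -expnSr c_order mul0rz mul0rn.
  + by case/eqP: ji; apply: val_inj.
- by move=> g /c_height.
Qed.

Lemma dvdz_shift (a b : nat) (x : int) : (b <= a)%N ->
  ((p ^ a.+1)%N%:Z %| x * (p ^ (a - b))%N%:Z)%Z = ((p ^ b.+1)%N%:Z %| x)%Z.
Proof.
move=> ba; have -> : a.+1 = (b.+1 + (a - b))%N by rewrite addSn subnKC.
rewrite expnD PoszM dvdz_mul2r //.
by rewrite eqz_nat -lt0n expn_gt0 prime_gt0.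
Qed.

Lemma h_mono i j : (i <= j)%N -> (h i <= h j)%N.
Proof. by rewrite leq_eqVlt => /predU1P[->//|/h_incr/ltnW]. Qed.

Lemma coef_power_dvd (P : {poly int}) :
  exists k, forall i, ((p ^ (h i).+1)%N%:Z %| (P *+ (p ^ k))`_i)%Z.
Proof.
exists (h (size P)).+1 => i; rewrite coefMnz.
have [ge|lt] := leqP (size P) i; first by rewrite nth_default // mul0r dvdz0.
rewrite dvdz_mull // dvdzE /=.
by rewrite dvdn_exp2l // ltnS h_mono // ltnW.
Qed.

(** Thus the [c i] generate the direct sum of their cyclic groups. Factors [p] are removed one at a
    time from a multiple of [P] that satisfies the divisibility, each time by
    [socle_independent]. *)
Lemma poly_comb_eq0 (P : {poly int}) :
  (poly_comb c P = 0) <-> (forall i, ((p ^ (h i).+1)%N%:Z %| P`_i)%Z).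
Proof.
split; last first.
  move=> dvdP; rewrite /poly_comb big1 // => i _.
  by have /dvdzP[k ->] := dvdP i; rewrite mulrC mulrzA -pmulrn c_order mul0rz.
move=> P0; have [k] := coef_power_dvd P.
elim: k => [|k IHk] dvdP; first by move=> i; have := dvdP i; rewrite expn0.
apply: IHk.
have dvdPk i : ((p ^ h i)%N%:Z %| (P *+ (p ^ k))`_i)%Z.
  have := dvdP i; rewrite (expnSr p k) mulrnA (coefMnz (P *+ _)).
  by rewrite expnSr PoszM dvdz_mul2r // eqz_nat -lt0n prime_gt0.
pose U := \poly_(i < size P) ((P *+ (p ^ k))`_i %/ (p ^ h i)%N%:Z)%Z.
have UE i : U`_i * (p ^ h i)%N%:Z = (P *+ (p ^ k))`_i.
  rewrite coef_poly; case: ltnP => [_|ge]; first by rewrite divzK.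
  by rewrite mul0r coefMnz nth_default // mul0r.
have U0 : poly_comb (fun i => c i *+ (p ^ h i)) U = 0.
  rewrite (poly_combE _ (size_poly _ _)).
  transitivity (poly_comb c P *+ (p ^ k)); last by rewrite P0 mul0rn.
  rewrite /poly_comb -sumrMnl; apply: eq_bigr => i _.
  by rewrite pmulrn -mulrzA mulrC UE coefMnz mulrzA.
move=> i; rewrite -UE expnS PoszM mulrC.
have /dvdzP[w ->] := socle_independent U0 i.
by rewrite mulrC -mulrA mulrC dvdz_mulr // dvdzz.
Qed.

Section Shifts.
(** Both [2j] and [2j+1] have half [j]: the odd indices serve the relations of the quotient, the
    even ones the embedding into it. *)
Local Notation e i := ((p ^ (h i - h i./2))%N%:Z).

Let half_lt i : odd i -> (h i./2 < h i)%N.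
Proof.
move=> oi; apply: h_incr; rewrite -{2}(odd_double_half i) oi add1n ltnS.
by rewrite -addnn leq_addr.
Qed.

Let half_le i : (h i./2 <= h i)%N.
Proof. by apply: h_mono; rewrite -{2}(odd_double_half i) -addnn addnA leq_addl. Qed.

Let half_ge (P : {poly int}) i : ((size P).*2 <= i)%N -> P`_(i./2) = 0.
Proof.
by move=> ge; apply: nth_default; rewrite -(doubleK (size P)) half_leq.
Qed.

(** The span of the [p^(h i + 1) X^i] and the [X^j - p^(h (2j+1) - h j) X^(2j+1)]; [R] collects the
    coefficients of the latter. *)
Let in_relations (P : {poly int}) := exists R : {poly int}, forall i,
  ((p ^ (h i).+1)%N%:Z %| P`_i - (R`_i - (if odd i then R`_(i./2) * e i else 0)))%Z.

Let relations_subgroup : is_subgroup in_relations.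
Proof.
split; first by exists 0 => i; rewrite !coef0 mul0r if_same !subr0 dvdz0.
move=> P Q [R hR] [S hS]; exists (R - S) => i; rewrite !coefB.
have dvd_eq (d x y : int) : (d %| x)%Z -> x = y -> (d %| y)%Z by move=> + <-.
apply: (dvd_eq _ _ _ (rpredB (hR i) (hS i))).
by case: (odd i) => /=; move: (e i) => z; ring.
Qed.

(** The additive map with [X^j |-> p^(h (2j) - h j) X^(2j)]. *)
Let shift_comb (P : {poly int}) : {poly int} :=
  \poly_(i < (size P).*2) (if odd i then 0 else P`_(i./2) * e i).

Let shift_combE P i :
  (shift_comb P)`_i = if odd i then 0 else P`_(i./2) * e i.
Proof.
rewrite coef_poly; case: ltnP => // /half_ge ->.
by rewrite mul0r if_same.
Qed.

Let shift_combB : {morph shift_comb : P Q / P - Q}.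
Proof.
move=> P Q; apply/polyP => i; rewrite coefB !shift_combE coefB.
by case: (odd i); rewrite ?subr0 // mulrBl.
Qed.

Let dvd_relations (P : {poly int}) :
  (forall i, ((p ^ (h i).+1)%N%:Z %| P`_i)%Z) -> in_relations P.
Proof.
by move=> dvdP; exists 0 => i; rewrite !coef0 mul0r if_same !subr0.
Qed.

Let dvd_shift_comb (P : {poly int}) :
  (forall i, ((p ^ (h i).+1)%N%:Z %| P`_i)%Z) -> in_relations (shift_comb P).
Proof.
move=> dvdP; apply: dvd_relations => i; rewrite shift_combE.
by case: (odd i); rewrite ?dvdz0 // dvdz_shift.
Qed.

(** Odd indices carry no term of [shift_comb P], so divisibility of [R] at [2k+1] passes down to
    [k], starting beyond the size of [R]. The even indices then give it for [P]. *)
Let shift_comb_inj (P : {poly int}) : in_relations (shift_comb P) ->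
  forall i, ((p ^ (h i).+1)%N%:Z %| P`_i)%Z.
Proof.
move=> [R hR].
have dvdR n k : (size R <= n + k)%N -> ((p ^ (h k).+1)%N%:Z %| R`_k)%Z.
  elim: n k => [|n IHn] k le; first by rewrite nth_default // dvdz0.
  have := hR k.*2.+1; rewrite shift_combE /= odd_double /= uphalf_double sub0r opprB.
  have /IHn dvd2 : (size R <= n + k.*2.+1)%N.
    by apply: leq_trans le _; rewrite addnS -addSn -addnn addnA leq_addr.
  have hk : (h k <= h k.*2.+1)%N by apply: h_mono; rewrite -addnn ltnW // ltnS leq_addr.
  by rewrite rpredBr // -(dvdz_shift _ hk).
move=> i; have := hR i.*2; rewrite shift_combE odd_double doubleK subr0.
have hi : (h i <= h i.*2)%N by apply: h_mono; rewrite -addnn leq_addr.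
rewrite rpredBr; last by apply: (dvdR (size R)); rewrite leq_addr.
by rewrite -(dvdz_shift _ hi).
Qed.

Let relations_divisible (P : {poly int}) : exists P1, in_relations (P - P1 *+ p).
Proof.
(* As [h j < h (2j+1)], one factor [p] splits off from the relation rewriting [X^j]. *)
exists (\poly_(i < (size P).*2)
  (if odd i then P`_(i./2) * (p ^ (h i - h i./2).-1)%N%:Z else 0)).
exists P => i; rewrite coefB coefMnz coef_poly.
suff -> : (if (i < (size P).*2)%N
    then if odd i then P`_(i./2) * (p ^ (h i - h i./2).-1)%N%:Z else 0 else 0)
    * p%:Z = if odd i then P`_(i./2) * e i else 0 by rewrite subrr dvdz0.
case: ltnP => [_|/half_ge ->]; last by rewrite !mul0r if_same.
case: ifP => oi; last by rewrite mul0r.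
by rewrite -mulrA -PoszM -expnSr prednK // subn_gt0 half_lt.
Qed.

(** A divisible quotient of the subgroup [C] generated by the [c i], into which
    [C] also embeds.  It is presented by the relations
    [c i = p^(h (2i+1) - h i) c (2i+1)], and [C] embeds into it through
    [c i |-> p^(h (2i) - h i) c (2i)]. *)
Lemma divisible_quotient : exists (Q : zmodType) (f1 f2 : {additive G -> Q}),
  [/\ divisible Q,
      forall y, exists P, f1 (poly_comb c P) = y &
      forall P, f2 (poly_comb c P) = 0 -> poly_comb c P = 0].
Proof.
have [H HE] := sg_zmodClosed relations_subgroup.
pose Q : zmodType := {ideal_quot H}.
have quot0 P : (quot_map H P = 0) <-> in_relations P.
  by rewrite quot_map_eq0; exact: HE.
have divQ : divisible Q.
  apply: (@pgroup_divisible _ p pp) => y; have [P <-] := quot_map_surj y.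
    have [k dvdPk] := coef_power_dvd P; exists k.
    by rewrite -raddfMn; apply/quot0; exact: dvd_relations.
  have [P1 P1E] := relations_divisible P; exists (quot_map H P1).
  apply/eqP; rewrite eq_sym -subr_eq0 -raddfMn -raddfB; apply/eqP.
  exact/quot0.
have [b bE] := additive_of_morphism shift_combB.
have [P|f1 f1E] := @divisible_extension _ _ _ (poly_comb c) (quot_map H) divQ.
  by move=> /poly_comb_eq0 dvdP; apply/quot0; exact: dvd_relations.
have [P|f2 f2E] := @divisible_extension _ _ _ (poly_comb c) (quot_map H \o b) divQ.
  by move=> /poly_comb_eq0 dvdP; apply/quot0; rewrite /= bE; exact: dvd_shift_comb.
exists Q, f1, f2; split=> // [y|P].
  by have [P <-] := quot_map_surj y; exists P; rewrite f1E.
rewrite f2E /= => /quot0; rewrite bE => /shift_comb_inj; exact: (poly_comb_eq0 P).2.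
Qed.
End Shifts.

(** With [C] and [Q] as above and [theta : G -> F_p] vanishing on [p G + G[p]] but
    not at [c 0], the map [(theta, f1, pr)] from [G] to [F_p x Q x G/C] is onto
    since [Q] is divisible and [F_p] is killed by [p], [(theta, f2, pr)] is
    injective, and the latter violates [co_Bassian_height] at [c 0] with
    [b = 1]. *)
Lemma unbounded_obstruction : (0 < h 0%N)%N -> ~ semi_generalized_co_Bassian G.
Proof.
move=> h0 coG; have [Q [f1 [f2 [divQ f1surj f2inj]]]] := divisible_quotient.
have hC : is_subgroup (fun x => exists P, x = poly_comb c P).
  split; first by exists 0; rewrite raddf0.
  by move=> _ _ [P ->] [P' ->]; exists (P - P'); rewrite raddfB.
have [C CE] := sg_zmodClosed hC.
pose Y (x : G) := exists g t : G, t *+ p = 0 /\ x = g *+ p + t.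
have hY : is_subgroup Y.
  split; first by exists 0, 0; rewrite !mul0rn addr0.
  move=> _ _ [g [t [t0 ->]]] [g' [t' [t'0 ->]]]; exists (g - g'), (t - t').
  by rewrite !mulrnBl t0 t'0 subrr opprD addrACA.
have nY : ~ Y (c 0%N).
  move=> [g [t [t0 cE]]]; apply: (@c_height 0%N g).
  have t1 : t *+ (p ^ h 0%N) = 0.
    by rewrite -(prednK h0) expnS mulrnA t0 mul0rn.
  by rewrite cE mulrnDl t1 addr0 -mulrnA -expnS.
have [g|||theta [thetaY theta1 _]] := @cyclic_functional G p pp 'F_p Y (c 0%N) 1 hY.
- by exists g, 0; rewrite mul0rn addr0.
- exact: nY.
- exact: pchar_Fp_0.
have [u uE] := additive_pair f1 (quot_map C).
have [v vE] := additive_pair f2 (quot_map C).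
have [q qE] := additive_pair theta u.
have [phi phiE] := additive_pair theta v.
have thetap x : theta (x *+ p) = 0.
  by apply: thetaY; exists x, 0; rewrite mul0rn addr0.
have quotC P : quot_map C (poly_comb c P) = 0.
  by apply/quot_map_eq0/CE; exists P.
have [y yE] := divQ (p ^ 1)%N (prime_gt0 pp) (f2 (c 0%N)).
have [||||t [[a a'] []]] := @co_Bassian_height G _ q phi p 1 (c 0%N) (0, (y, 0)) coG.
(* For surjectivity, [g] settles the component in [G/C], a multiple of [c 0] the one in [F_p], and
   an element of [p C], killed by [theta], the one in [Q]. *)
- move=> [k [z d]]; have [g <-] := quot_map_surj d.
  have [z1 z1E] := divQ p (prime_gt0 pp) (z - f1 g).
  have [P PE] := f1surj z1.
  have [k' k'E] : exists n : nat, n%:R = k - theta g by exists (k - theta g); exact: natr_Zp.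
  have [z2 z2E] := divQ p (prime_gt0 pp) (f1 (c 0%N *+ k')).
  have [P2 P2E] := f1surj z2.
  exists (g + (poly_comb c P - poly_comb c P2) *+ p + c 0%N *+ k').
  have c0E : c 0%N = poly_comb c 1 by rewrite poly_comb1.
  rewrite qE uE !raddfD; congr (_, (_, _)) => /=.
  + by rewrite thetap addr0 raddfMn /= theta1 k'E addrC subrK.
  + by rewrite raddfMn raddfB /= PE P2E mulrnBl z1E z2E -addrA subrK addrC subrK.
  + by rewrite c0E !raddfMn raddfB /= !quotC subrr !mul0rn !addr0.
- move=> g; rewrite phiE vE => -[_ f20 /quot_map_eq0 /CE[P gP]].
  by rewrite gP in f20 *; exact: f2inj.
- exact: pp.
- rewrite phiE vE; have -> : quot_map C (c 0%N) = 0 by rewrite -(poly_comb1 c) quotC.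
  rewrite !pairMn -raddfMn thetap mul0rn; congr (_, (_, _)).
  + by rewrite mul0rn.
  + by rewrite -yE -mulrnA -expnSr.
  + by rewrite !mul0rn.
(* The height condition would make [theta (c 0 - t) = 1] a multiple of [p] in [F_p]. *)
move=> t0; rewrite phiE !pairMn => -[+ _]; rewrite raddfB /= theta1.
have -> : theta t = 0 by apply: thetaY; exists 0, t; rewrite mul0rn add0r.
have -> : a *+ (p ^ 1) = 0 by rewrite expn1 -mulr_natr pchar_Fp_0 ?mulr0.
by rewrite subr0 => /eqP; rewrite oner_eq0.
Qed.
End Independence.

Lemma co_Bassian_stable_height (G : zmodType) (p : nat) : prime p ->
  semi_generalized_co_Bassian G -> exists n, stable_height G p n.
Proof.
move=> pp coG; apply: contrapT => unstable.
have step n : exists mc : nat * G, [/\ (n <= mc.1)%N, mc.2 *+ (p ^ mc.1.+1) = 0 &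
    forall g, mc.2 *+ (p ^ mc.1) <> g *+ (p ^ mc.1.+1)].
  apply: contrapT => none; apply: unstable; exists n.
  have div m (c : G) : (n <= m)%N -> c *+ (p ^ m.+1) = 0 ->
      exists g, c *+ (p ^ m) = g *+ (p ^ m.+1).
    move=> nm c0; apply: contrapT => ng; apply: none; exists (m, c).
    by split=> //= g gE; apply: ng; exists g.
  (* Induction on the order of [x]: subtracting [g *+ p] lowers it. *)
  have stab e (x : G) : x *+ (p ^ (n + e)) = 0 ->
      exists2 y, y \in pcomponent_subgroup G p & x *+ (p ^ n) = y *+ (p ^ n.+1).
    elim: e x => [|e IHe] x x0.
      by exists 0; rewrite ?rpred0 // mul0rn; rewrite addn0 in x0.
    have [||g gE] := div (n + e)%N x; [exact: leq_addr|by rewrite -addnS|].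
    have [|y yT yE] := IHe (x - g *+ p).
      by rewrite mulrnBl gE -mulrnA -expnS subrr.
    have gT : g \in pcomponent_subgroup G p.
      apply/in_pcomponent; exists (n + e).+2; rewrite expnSr mulrnA -gE -mulrnA -expnSr.
      by rewrite -addnS.
    exists (y + g); first exact: rpredD.
    by rewrite mulrnDl -yE mulrnBl -mulrnA -expnS subrK.
  move=> x /in_pcomponent[k xk]; apply: (stab k).
  by rewrite expnD mulnC mulrnA xk mul0rn.
have [f fE] := choice step.
(* Starting at [1] makes [h 0] positive, as [unbounded_obstruction] requires. *)
pose k i := iter i (fun j => (f j).1.+1) 1%N.
pose h i := (f (k i)).1.
have hS i : (h i < h i.+1)%N by have [] := fE (k i.+1).
have h_incr i j : (i < j)%N -> (h i < h j)%N.
  elim: j => // j IHj; rewrite ltnS leq_eqVlt => /predU1P[->//|/IHj lt].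
  exact: ltn_trans lt (hS j).
apply: (@unbounded_obstruction G p pp (fun i => (f (k i)).2) h) => //.
- by move=> i; have [] := fE (k i).
- by move=> i; have [] := fE (k i).
- by have [] := fE 1%N.
Qed.

(** * Elementary groups of infinite rank *)

Lemma addrBACA (G : zmodType) (a b c d : G) :
  (a - b) + (c - d) = (a + c) - (b + d).
Proof. by rewrite opprD addrACA. Qed.

Section Span.
Variable G : zmodType.

Fixpoint zspan (s : seq G) (x : G) : Prop :=
  if s is y :: s' then exists k : int, zspan s' (x - y *~ k) else x = 0.

Lemma zspan_is_subgroup s : is_subgroup (zspan s).
Proof.
elim: s => [|y s IHs] /=; first exact: zero_is_subgroup.
split; first by exists 0; rewrite subrr; exact: sg0.
move=> a b [k sa] [l sb]; exists (k - l).
by have := sgB IHs sa sb; rewrite mulrzBr !opprD !opprK addrACA.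
Qed.

Lemma zspan_cat s s' x y : zspan s x -> zspan s' y -> zspan (s ++ s') (x + y).
Proof.
elim: s x => [|z s IHs] x /=; first by move=> ->; rewrite add0r.
by move=> [k sx] sy; exists k; rewrite addrAC; exact: IHs.
Qed.

Definition finitely_spanned (V : G -> Prop) :=
  exists2 s, forall x, x \in s -> V x & forall x, V x -> zspan s x.

(** Greedy choice: each term lies outside the span of the earlier ones, so the last coefficient of a
    relation is divisible by [p]. *)
Lemma independent_sequence (p : nat) (V : G -> Prop) : prime p ->
  (forall x, V x -> x *+ p = 0) -> ~ finitely_spanned V ->
  exists e : nat -> G, (forall i, V (e i)) /\
    forall P, poly_comb e P = 0 -> forall i, (p%:Z %| P`_i)%Z.
Proof.
move=> pp pV nV.
have step s : exists y, (forall x, x \in s -> V x) -> V y /\ ~ zspan s y.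
  have [sV|nsV] := pselect (forall x, x \in s -> V x); last by exists 0.
  apply: contrapT => none; apply: nV; exists s => // x Vx.
  by apply: contrapT => nx; apply: none; exists x.
have [f fE] := choice step.
pose S i := iter i (fun s => f s :: s) [::].
have SV i x : x \in S i -> V x.
  elim: i x => // i IHi x; rewrite inE => /orP[/eqP ->|]; last exact: IHi.
  by have [] := fE _ IHi.
have eV i : V (f (S i)) by have [] := fE _ (SV i).
have sumS (a : nat -> int) n : zspan (S n) (\sum_(i < n) f (S i) *~ a i).
  elim: n => [|n IHn]; first by rewrite big_ord0.
  by rewrite big_ord_recr /=; exists (a n); rewrite addrK.
have indep (a : nat -> int) n :
    \sum_(i < n) f (S i) *~ a i = 0 -> forall i, (i < n)%N -> (p%:Z %| a i)%Z.
  elim: n => // n IHn; rewrite big_ord_recr /= => /eqP; rewrite addr_eq0 => /eqP sE.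
  have an : (p%:Z %| a n)%Z.
    apply: contraT => /(ndvdz_coprime pp) pan; have [_ []] := fE _ (SV n).
    have hS := zspan_is_subgroup (S n).
    apply: (@sg_coprime G _ _ _ _ hS pan); first by rewrite -pmulrn pV //; exact: sg0.
    by rewrite -[_ *~ _]opprK -sE; apply: (sgN hS).
  move=> i; rewrite ltnS leq_eqVlt => /predU1P[->//|]; apply: IHn.
  have /dvdzP[w aE] := an.
  by rewrite sE aE mulrC mulrzA -pmulrn pV // mul0rz oppr0.
exists (fun i => f (S i)); split=> // P P0 i.
have [ge|lt] := leqP (size P) i; first by rewrite nth_default // dvdz0.
exact: (indep (fun i => P`_i) (size P)).
Qed.
End Span.

Lemma finitely_spanned_image (G : zmodType) (H : zmodClosed G) (V : G -> Prop) :
  (forall x, V x -> x \in H) ->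
  finitely_spanned (fun w : subgroup H => V (val w)) -> finitely_spanned V.
Proof.
move=> VH [s sV Vs]; exists (map val s).
  by move=> _ /mapP[w ws ->]; exact: sV.
have spanE t (w : subgroup H) : zspan t w -> zspan (map val t) (val w).
  elim: t w => [|y t IHt] w /=; first by move=> ->.
  by move=> [k /IHt]; rewrite raddfB raddfMz; exists k.
move=> x Vx; have [w wx] := subgroup_lift (VH x Vx).
by rewrite -wx; apply: spanE; apply: Vs; rewrite wx.
Qed.

Section Elementary.
Variables (W : zmodType) (p : nat) (pp : prime p).
Hypothesis pW : forall w : W, w *+ p = 0.
Variables (V : W -> Prop) (hV : is_subgroup V) (nV : ~ finitely_spanned V).

(** The shift [e i |-> e (i+1)] on the span of an independent sequence in [V], extended by the
    identity on a complement, misses [e 0]. Multiplication by ['X] expresses the shift. *)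
Lemma shift_endomorphism : exists f : {additive W -> W},
  [/\ forall w, f w = 0 -> w = 0, forall w, V w -> V (f w) &
      exists2 v, V v & forall w, f w <> v].
Proof.
have [e [eV e_indep]] := independent_sequence pp (fun x _ => pW x) nV.
pose S (x : W) := exists P, x = poly_comb e P.
have hS : is_subgroup S.
  split; first by exists 0; rewrite raddf0.
  by move=> _ _ [P ->] [Q ->]; exists (P - Q); rewrite raddfB.
have SV x : S x -> V x.
  by move=> [P ->]; apply: (sg_sum hV) => i _; exact: (sgMz hV).
have [x _|x _|//|C [hC _ _ CS CS0]] := elementary_complement pp
  (setT_is_subgroup W) (zero_is_subgroup W) hS; [exact: pW|by []|].
have [x Sx Cx|x|r [rS rC r1 r0]] := complement_projection hS hC.
- exact: CS0.
- by have [c [s [Cc Ss ->]]] := CS x I; exists s, c; rewrite addrC.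
have [b bE] : exists b : {additive {poly int} -> W}, b =1 (fun P => poly_comb e (P * 'X)).
  by apply: additive_of_morphism => P Q; rewrite mulrBl raddfB.
have comb0 (P : {poly int}) : (forall i, (p%:Z %| P`_i)%Z) -> poly_comb e P = 0.
  move=> dvdP; rewrite /poly_comb big1 // => i _.
  by have /dvdzP[k ->] := dvdP i; rewrite mulrC mulrzA -pmulrn pW mul0rz.
have [||f fE] := @bounded_extension _ _ _ p 1 (poly_comb e) b pp.
- move=> [|[|//]] w _ w0; first by exists w.
  by exists 0; rewrite mul0rn -w0.
- move=> P g; rewrite pW => P0; rewrite bE; apply: comb0 => i.
  by rewrite coefMX; case: i => [|i] //=; exact: e_indep.
have fS x : S x -> S (f x).
  by move=> [P ->]; rewrite fE bE; exists (P * 'X).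
have f_inj x : S x -> f x = 0 -> x = 0.
  move=> [P ->]; rewrite fE bE => /e_indep dvdP; apply: comb0 => i.
  by have := dvdP i.+1; rewrite coefMX.
have [s sE] : exists s : {additive W -> W}, s =1 (fun w => f (r w) + (w - r w)).
  apply: additive_of_morphism => x y.
  by rewrite (raddfB r) (raddfB f) /= [in RHS]opprD [RHS]addrACA; congr (_ + _);
    rewrite !opprD !opprK addrACA.
have rs w : r (s w) = f (r w).
  have Sf : S (f (r w)) by apply/fS/rS.
  by rewrite sE raddfD /= (r1 _ Sf) (r0 _ (rC w)) addr0.
exists s; split.
- move=> w w0; have rw0 : r w = 0.
    by apply: f_inj; [exact: rS | rewrite -rs w0 raddf0].
  by move: w0; rewrite sE rw0 raddf0 subr0 add0r.
- move=> w Vw; rewrite sE; apply: (sgD hV); first by apply/SV/fS/rS.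
  by apply: (sgB hV) => //; apply/SV/rS.
- exists (poly_comb e 1); first by apply: SV; exists 1.
  move=> w /(congr1 r); rewrite rs (r1 (poly_comb e 1)); last by exists 1.
  have [P ->] := rS w; rewrite fE bE => /eqP; rewrite -subr_eq0 -raddfB => /eqP.
  move=> /e_indep /(_ 0%N); rewrite coefB coefMX coef1 /= sub0r dvdzE /=.
  by rewrite dvdn1 => /eqP p1; have := pp; rewrite p1.
Qed.

(** A Hilbert hotel argument: for each new generator in [s], the shift frees the vector [v0] of [V]
    to receive it. *)
Lemma embedding_of_finite_extension (s : seq W) :
  (forall w, exists2 v, V v & zspan s (w - v)) ->
  exists f : {additive W -> W}, (forall w, f w = 0 -> w = 0) /\ forall w, V (f w).
Proof.
move=> sW; have [sh [sh_inj shV [v0 Vv0 v0sh]]] := shift_endomorphism.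
suff [f fE] : exists f : {additive W -> W}, forall w,
    (exists2 v, V v & zspan s (w - v)) -> V (f w) /\ (f w = 0 -> w = 0).
  by exists f; split=> w; have [] := fE w (sW w).
elim: (s) => [|y t [f fE]].
  exists idfun => w [v Vv /= /eqP]; rewrite subr_eq0 => /eqP ->.
  by split.
pose U (w : W) := exists2 v, V v & zspan t (w - v).
have hU : is_subgroup U.
  have ht := zspan_is_subgroup t.
  split; first by exists 0; [exact: sg0 | rewrite subrr; exact: sg0].
  move=> a b [v Vv tv] [v' Vv' tv']; exists (v - v'); first exact: sgB.
  by have := sgB ht tv tv'; rewrite !opprD !opprK addrACA.
have UyE w : (exists2 v, V v & zspan (y :: t) (w - v)) ->
    exists k : int, U (w - y *~ k).
  by move=> [v Vv [k tw]]; exists k, v => //; rewrite addrAC.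
have [Uy|nUy] := pselect (U y).
  exists f => w /UyE[k Uw]; apply: fE.
  by have := sgD hU Uw (sgMz hU k Uy); rewrite subrK.
have pU g : U (g *+ p) by rewrite pW; exact: sg0.
have [th [thU thy _]] := cyclic_functional pp hU pU nUy (pW v0).
have [ty [tyU tyy _]] := cyclic_functional pp hU pU nUy (pW y).
(* [ty] is the component along [y], and [th] sends that component to [v0], outside the image of
   [sh]. *)
have [f' f'E] : exists f' : {additive W -> W},
    f' =1 (fun w => sh (f (w - ty w)) + th w).
  apply: additive_of_morphism => a b.
  have -> : a - b - ty (a - b) = (a - ty a) - (b - ty b).
    by rewrite raddfB !opprD !opprK addrACA.
  by rewrite (raddfB f (a - ty a)) (raddfB sh (f _)) (raddfB th) /= addrBACA.
exists f' => w /UyE[k Uw].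
have tyw : ty w = y *~ k by rewrite -[in LHS](subrK (y *~ k) w) raddfD raddfMz /= tyU // tyy add0r.
have thw : th w = v0 *~ k by rewrite -[in LHS](subrK (y *~ k) w) raddfD raddfMz /= thU // thy add0r.
have [Vf f0] := fE _ Uw.
rewrite f'E tyw thw; split.
  by apply: (sgD hV); [exact: shV | exact: (sgMz hV)].
have [/dvdzP[j kE]|/(ndvdz_coprime pp) pk] := boolP (p%:Z %| k)%Z.
  have zk (z : W) : z *~ k = 0 by rewrite kE mulrC mulrzA -pmulrn pW mul0rz.
  by rewrite !zk addr0 subr0 in f0 * => /sh_inj.
move/eqP; rewrite addrC addr_eq0 => /eqP v0E.
pose S (z : W) := exists w, sh w = z.
have hS : is_subgroup S := image_is_subgroup _.
have [] : S v0.
  apply: (@sg_coprime W S v0 _ _ hS pk); first by rewrite -pmulrn pW; exact: sg0.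
  by exists (- f (w - y *~ k)); rewrite v0E raddfN.
by move=> z /v0sh.
Qed.
End Elementary.

(** * Groups whose torsion-free quotient is not p-divisible *)

Lemma subgroup_inclusion (G : zmodType) (H K : zmodClosed G) :
  {subset H <= K} ->
  exists i : {additive subgroup H -> subgroup K}, forall x, val (i x) = val x.
Proof.
move=> HK.
have [|||i iE] := @additive_of_relation (subgroup H) (subgroup K) (fun x y => val y = val x).
- by move=> x y x' y' xy xy'; rewrite !raddfB /= xy xy'.
- by move=> y; rewrite raddf0 => y0; exact: val_inj.
- by move=> x; have [y yx] := subgroup_lift (HK _ (valP x)); exists y.
by exists i.
Qed.

Lemma pgroup_inj (G A : zmodType) (p : nat) (f : {additive G -> A}) (S : G -> Prop) :
  (forall x, S x -> S (x *+ p)) -> (forall x, S x -> exists k, x *+ (p ^ k) = 0) ->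
  (forall x, S x -> x *+ p = 0 -> f x = 0 -> x = 0) ->
  forall x, S x -> f x = 0 -> x = 0.
Proof.
move=> pS torS soc x Sx; have [k] := torS x Sx.
elim: k x Sx => [|k IHk] x Sx xk fx; first by rewrite expn0 in xk.
apply: soc => //; apply: IHk; first exact: pS.
  by rewrite -mulrnA -expnS.
by rewrite raddfMn fx mul0rn.
Qed.

Section Homogeneous.
Variables (G : zmodType) (p : nat) (pp : prime p) (m : nat) (V : G -> Prop).
Hypothesis hV : is_subgroup V.
Hypothesis pV : forall v, V v -> v *+ p = 0.
Hypothesis V_height : forall v, V v -> exists g, v = g *+ (p ^ m).

(** A maximal subgroup satisfying the last two conditions contains [V]: if it missed
    [v = x *+ (p ^ m)], the cyclic group of [x] would meet it trivially and could be added. *)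
Lemma homogeneous_subgroup : exists N : zmodClosed G,
  [/\ forall v, V v -> v \in N, forall x, x \in N -> x *+ (p ^ m.+1) = 0 &
      forall x, x \in N -> x *+ p = 0 ->
        V x /\ exists2 u, u \in N & u *+ (p ^ m) = x].
Proof.
pose P (S : G -> Prop) x := x *+ (p ^ m.+1) = 0 /\
  (x *+ p = 0 -> V x /\ exists2 u, S u & u *+ (p ^ m) = x).
have [S S' x SS' [xp soc]|_ ->|M [hM _ PM Mmax]] :=
    @subgroup_zorn G P _ (zero_is_subgroup G).
- split=> // /soc[Vx [u Su ux]]; split=> //; exists u => //; exact: SS'.
- split=> [|_]; first by rewrite mul0rn.
  by split; [exact: sg0 | exists 0; rewrite ?mul0rn].
have VM v : V v -> M v.
  move=> Vv; apply: contrapT => nMv; have [x vE] := V_height Vv.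
  have xp : x *+ (p ^ m.+1) = 0 by rewrite expnSr mulrnA -vE pV.
  have dvdM (j : int) i : (i <= m.+1)%N -> M (x *~ j) -> ((p ^ i)%N%:Z %| j)%Z.
    elim: i => [|i IHi] le Mj; first by rewrite expn0 dvd1z.
    have /dvdzP[j' jE] := IHi (ltnW le) Mj.
    rewrite jE mulrC expnSr PoszM dvdz_mul ?dvdzz //.
    apply: contraT => /(ndvdz_coprime pp) pj'; case: nMv.
    apply: (@sg_coprime G M v _ _ hM pj').
      by rewrite -pmulrn pV //; exact: sg0.
    have := sgMn hM (p ^ (m - i)) Mj.
    rewrite jE pmulrn -mulrzA -mulrA [j' * _]mulrC -PoszM -expnD subnKC //.
    by rewrite mulrzA -pmulrn -vE.
  pose M' y := exists k : int, M (y - x *~ k).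
  have hM' : is_subgroup M'.
    split; first by exists 0; rewrite subrr; exact: (sg0 hM).
    move=> a b [k Mk] [l Ml]; exists (k - l).
    by have := sgB hM Mk Ml; rewrite mulrzBr !opprD !opprK addrACA.
  have MM' y : M y -> M' y by move=> My; exists 0; rewrite subr0.
  have M'x : M' x by exists 1; rewrite subrr; exact: (sg0 hM).
  have Mx : M x.
    apply: (Mmax M' hM' MM') => // y [k Mk].
    have [nm nsoc] := PM _ Mk; rewrite -[y](subrK (x *~ k)).
    set n := y - x *~ k in Mk nm nsoc *; split.
      by rewrite mulrnDl nm add0r pmulrn mulrzAC -pmulrn xp mul0rz.
    move=> /eqP; rewrite mulrnDl addr_eq0 => /eqP nE.
    have /(dvdM _ m.+1 (leqnn _)) : M (x *~ (k * p%:Z)).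
      rewrite mulrzA -pmulrn -[_ *+ _]opprK -nE; apply: (sgN hM).
      exact: (sgMn hM).
    rewrite expnSr PoszM dvdz_mul2r ?eqz_nat -?lt0n ?prime_gt0 // => /dvdzP[k' kE].
    have xk : x *~ k = v *~ k' by rewrite kE mulrC mulrzA -pmulrn -vE.
    have n0 : n *+ p = 0.
      by rewrite nE xk pmulrn mulrzAC -pmulrn pV // mul0rz oppr0.
    have [Vn [u Mu uE]] := nsoc n0; rewrite xk; split.
      by apply: (sgD hV) => //; exact: (sgMz hV).
    exists (u + x *~ k'); last by rewrite mulrnDl uE pmulrn mulrzAC -pmulrn -vE.
    by exists k'; rewrite addrK.
  by apply: nMv; rewrite vE; exact: (sgMn hM).
have [N NE] := sg_zmodClosed hM; exists N; split.
- by move=> v /VM /NE.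
- by move=> x /NE /PM[].
- move=> x /NE /PM[_ soc] /soc[Vx [u Mu ux]]; split=> //; exists u => //; exact/NE.
Qed.

(** This is what [bounded_extension] asks of [N] at exponent [m + 1]. By induction on the order of
    [w], a multiple of some [u'] with the same top power in the socle is subtracted. *)
Lemma homogeneous_divisible (N : zmodClosed G) :
  (forall x, x \in N -> x *+ p = 0 ->
     V x /\ exists2 u, u \in N & u *+ (p ^ m) = x) ->
  forall j (w : subgroup N), (j <= m.+1)%N -> w *+ (p ^ (m.+1 - j)) = 0 ->
    exists y : subgroup N, y *+ (p ^ j) = w.
Proof.
move=> soc j w jm; rewrite -{2}(subKn jm).
move: (m.+1 - j)%N (leq_subr j m.+1) => i {j jm}.
elim: i w => [|i IHi] w im w0.
  by exists 0; rewrite mul0rn; rewrite expn0 in w0.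
have [||_ [u uN uE]] := soc (val (w *+ (p ^ i))); first exact: valP.
  by rewrite -raddfMn -mulrnA -expnSr w0 raddf0.
have [u' u'E] := subgroup_lift uN.
have uE' : u' *+ (p ^ m) = w *+ (p ^ i) by apply: val_inj; rewrite raddfMn /= u'E.
have im' : (i <= m)%N by [].
have [||y yE] := IHi (w - u' *+ (p ^ (m - i))); first exact: ltnW.
  by rewrite mulrnBl -mulrnA -expnD subnK // uE' subrr.
exists (u' + y *+ p); rewrite subSS mulrnDl -mulrnA -expnS -subSn // yE.
by rewrite addrC subrK.
Qed.
End Homogeneous.

Section TorsionFreeObstruction.
Variables (G : zmodType) (p : nat) (pp : prime p).
Local Notation T := (pcomponent_subgroup G p).
Hypothesis coG : semi_generalized_co_Bassian G.
Variable r : {additive G -> G}.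
Hypotheses (rT : forall x, r x \in T) (r1 : forall x, x \in T -> r x = x).
Hypothesis ndiv : ~ p_divisible p {ideal_quot torsion_subgroup G}.

(** Otherwise [co_Bassian_height] fails for the injective endomorphism of [G]
    that is [f] on [T_p], and multiplication by [p^b] plus [th] on a complement,
    where [th] is a homomorphism onto the subgroup generated by [s]. *)
Lemma socle_covered (f : {additive G -> G}) (b : nat) (s : G) :
  (forall x, x \in T -> f x \in T) -> (forall x, x \in T -> f x = 0 -> x = 0) ->
  s *+ p = 0 -> exists t g, t *+ p = 0 /\ s = g *+ (p ^ b) + f t.
Proof.
move=> fT f_inj s0.
pose Y (x : G) := exists g t : G, t \in T /\ x = g *+ p + t.
have hY : is_subgroup Y.
  split; first by exists 0, 0; rewrite rpred0 mul0rn addr0.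
  move=> _ _ [g [t [tT ->]]] [g' [t' [tT' ->]]]; exists (g - g'), (t - t').
  by rewrite rpredB // mulrnBl opprD addrACA.
have Tt x : x \in T -> x \in torsion_subgroup G.
  move=> /in_pcomponent[k xk]; apply/asboolP; exists (p ^ k)%N => //.
  by rewrite expn_gt0 prime_gt0.
(* If [p G + T_p] were [G], then [G/T] would be [p]-divisible. *)
have [x nYx] : exists x, ~ Y x.
  apply: contrapT => none; apply: ndiv => y; have [x <-] := quot_map_surj y.
  have [g [t [tT ->]]] : Y x by apply: contrapT => nYx; apply: none; exists x.
  exists (quot_map _ g); rewrite -raddfMn raddfD /=.
  by have /quot_map_eq0 -> := Tt t tT; rewrite addr0.
have TY x' : x' \in T -> Y x' by move=> xT; exists 0, x'; rewrite mul0rn add0r.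
have pY g : Y (g *+ p) by exists g, 0; rewrite rpred0 addr0.
have [th [thY thx thm]] := cyclic_functional pp hY pY nYx s0.
have thT g : th g \in T.
  have [k ->] := thm g; apply: (sgMz (closed_is_subgroup T)).
  exact: socle_pcomponent.
have r0 g : r (g - r g) = 0 by rewrite raddfB (r1 (rT g)) subrr.
have [phi phiE] : exists phi : {additive G -> G},
    phi =1 (fun g => f (r g) + (g - r g) *+ (p ^ b) + th g).
  apply: additive_of_morphism => x1 y1.
  rewrite (raddfB th) (raddfB r) (raddfB f) /= -!addrBACA -mulrnBl.
  by congr (_ + _ *+ _ + _); rewrite !opprD !opprK addrACA.
pose x' := x - r x.
have thx' : th x' = s by rewrite raddfB thx (thY _ (TY _ (rT x))) subr0.
have phiT t : t \in T -> phi t = f t.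
  by move=> tT; rewrite phiE (thY _ (TY _ tT)) r1 // subrr mul0rn !addr0.
have phix' : phi x' = x' *+ (p ^ b) + s.
  by rewrite phiE r0 thx' raddf0 add0r subr0.
(* Since [s] is killed by [p], [phi x' *+ p] is [x' *+ (p ^ b.+1)]; the resulting [a'] gives
   [s = (a' - x') *+ (p ^ b) + f t]. *)
have [||||t [a' [t0 tE]]] := @co_Bassian_height G G idfun phi p b x' x' coG.
- by move=> a; exists a.
- move=> g g0; have gT : g - r g \in T.
    apply: (@pcomponent_divX G p _ b).
    move/eqP: g0; rewrite phiE -addrA addrCA addr_eq0 => /eqP ->.
    by rewrite rpredN rpredD // fT.
  have gT' : g \in T by rewrite -[g](subrK (r g)) rpredD.
  by apply: f_inj => //; rewrite -phiT.
- exact: pp.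
- by rewrite phix' mulrnDl s0 addr0 -mulrnA -expnSr.
exists t, (a' - x'); split=> //.
rewrite mulrnBl -tE raddfB /= phix' phiT; last exact: socle_pcomponent.
by rewrite addrAC subrK addrC addKr.
Qed.

(** [V] is the socle of a summand [N] that is a direct sum of cyclic groups of
    order [p^(m+1)]; if [V] is infinite, an injective endomorphism of [V] that is
    not onto extends to [N]. *)
Lemma homogeneous_socle_spanned (m : nat) (V : G -> Prop) :
  is_subgroup V -> (forall v, V v -> v *+ p = 0) ->
  (forall v, V v -> exists g, v = g *+ (p ^ m)) ->
  (forall v g, V v -> v = g *+ (p ^ m.+1) -> v = 0) ->
  finitely_spanned V.
Proof.
move=> hV pV V_height V_pure; apply: contrapT => nV.
have [N [VN N0 Nsoc]] := homogeneous_subgroup pp hV pV V_height.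
have Ndiv := homogeneous_divisible Nsoc.
have [HV HVE] := sg_zmodClosed hV.
have VHN : {subset HV <= N} by move=> x /HVE /VN.
have NT x : x \in N -> x \in T by move=> /N0 x0; apply/in_pcomponent; exists m.+1.
have Npure w g : w \in N -> w = g *+ (p ^ m.+1) -> w = 0.
  move=> wN; have [i] : exists i, w *+ (p ^ i) = 0 by exists m.+1; exact: N0.
  elim: i w g wN => [|i IHi] w g wN wi wg; first by rewrite expn0 in wi.
  have wp : w *+ p = 0.
    apply: (IHi _ (g *+ p)); [exact: rpredMn| |by rewrite wg mulrnAC].
    by rewrite -mulrnA -expnS.
  by have [Vw _] := Nsoc w wN wp; exact: V_pure Vw wg.
(* [N] meets [p^(m+1) G] trivially, which gives a retraction [R] of [G] onto [N]. *)
have [u g ug|R RE] := @bounded_extension _ _ _ p m.+1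
    (val : {additive subgroup N -> G}) (idfun : {additive subgroup N -> subgroup N})
    pp Ndiv.
  by apply: val_inj; apply: Npure ug; exact: valP.
have RN x : x \in N -> val (R x) = x.
  by move=> xN; have [u <-] := subgroup_lift xN; rewrite RE.
have pHV (w : subgroup HV) : w *+ p = 0.
  by apply: val_inj; rewrite raddfMn /= pV //; apply/HVE; exact: valP.
have nHV : ~ finitely_spanned (fun _ : subgroup HV => True).
  move=> [s _ sV]; apply: nV; apply: (@finitely_spanned_image _ HV); first by move=> x /HVE.
  by exists s => [x _|x _]; [apply/HVE; exact: valP | exact: sV].
have [sh [sh_inj _ [v0 _ v0sh]]] :=
  shift_endomorphism pp pHV (setT_is_subgroup _) nHV.
have [i iE] := subgroup_inclusion VHN.
have [u g ug|S SE] := @bounded_extension _ _ _ p m.+1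
    (val : {additive subgroup HV -> G}) (i \o sh) pp Ndiv.
  have -> : u = 0 by apply: val_inj; apply: V_pure ug; apply/HVE; exact: valP.
  exact: raddf0.
have S_inj x : x \in N -> S x = 0 -> x = 0.
  apply: (@pgroup_inj G _ p S (fun x => x \in N)) => {x}.
  - by move=> x; exact: rpredMn.
  - by move=> x /N0 xN; exists m.+1.
  - move=> x xN /(Nsoc _ xN)[/HVE xV _]; have [u <-] := subgroup_lift xV.
    rewrite SE /= => /(congr1 val); rewrite iE raddf0 => u0.
    by rewrite (sh_inj u) ?raddf0 //; exact: val_inj.
(* [f] is [S] on [N] and the identity on the kernel of [R]. *)
have [f fE] : exists f : {additive G -> G},
    f =1 (fun g => val (S (val (R g))) + (g - val (R g))).
  apply: additive_of_morphism => x y.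
  rewrite (raddfB R) /= (raddfB S) /= [in RHS]opprD [RHS]addrACA.
  by congr (_ + _); rewrite !opprD !opprK addrACA.
have valN (w : subgroup N) : val w \in N by exact: valP.
have Rf g : R (f g) = S (val (R g)).
  rewrite fE raddfD raddfB /=; apply: val_inj; rewrite raddfD raddfB /=.
  by rewrite (RN _ (valN (S _))) (RN _ (valN (R g))) subrr addr0.
have [|||t [g [t0 v0E]]] := @socle_covered f m.+1 (val v0).
- by move=> x xT; rewrite fE rpredD ?rpredB //; exact/NT/valN.
- move=> x _ x0; have RS : S (val (R x)) = 0 by rewrite -Rf x0 raddf0.
  have Rx : val (R x) = 0 by apply: S_inj.
  by move: x0; rewrite fE RS Rx raddf0 subr0 add0r.
- by apply: pV; apply/HVE; exact: valP.
(* [R] kills [g *+ (p ^ m.+1)], so applying it to [v0E] exhibits [v0] as the image of [R t] under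
   the shift. *)
have Rt : exists w : subgroup HV, val w = val (R t).
  apply: subgroup_lift; apply/HVE.
  have [|//] := Nsoc (val (R t)) (valN _).
  by rewrite -!raddfMn t0 !raddf0.
have [w wE] := Rt; apply: (v0sh w); apply: val_inj.
have /RN <- : val v0 \in N by apply: VHN; exact: valP.
have SEw : S (val w) = i (sh w) := SE w.
rewrite -iE -SEw wE -Rf v0E raddfD raddfMn.
suff -> : R g *+ (p ^ m.+1) = 0 by rewrite add0r.
by apply: val_inj; rewrite raddfMn /= (N0 _ (valN _)).
Qed.
End TorsionFreeObstruction.

(** * Finite spanning sets of the socle and finite p-rank *)

Section FinitePrank.
Variables (G : zmodType) (p : nat) (pp : prime p).

Fixpoint irredundant (s : seq G) : Prop :=
  if s is y :: s' then ~ zspan s' y /\ irredundant s' else True.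

Lemma irredundant_spanning (V : G -> Prop) : finitely_spanned V ->
  exists s, [/\ irredundant s, forall x, x \in s -> V x & forall x, V x -> zspan s x].
Proof.
move=> [t tV Vt].
suff [s [irs sV ts]] : exists s, [/\ irredundant s, forall x, x \in s -> V x &
    forall x, zspan t x -> zspan s x].
  by exists s; split=> // x /Vt /ts.
elim: (t) tV => [|y t' IHt] tV; first by exists [::].
have [|s [irs sV ts]] := IHt; first by move=> x xt; apply: tV; rewrite inE xt orbT.
have [sy|nsy] := pselect (zspan s y).
  exists s; split=> // x [k /ts sx].
  have hs := zspan_is_subgroup s.
  by have := sgD hs sx (sgMz hs k sy); rewrite subrK.
exists (y :: s); split=> // [x|x [k /ts sx]]; last by exists k.
by rewrite inE => /orP[/eqP ->|/sV//]; apply: tV; rewrite inE eqxx.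
Qed.

Lemma zspan_sum (s : seq G) x : zspan s x ->
  exists a : nat -> int, x = \sum_(i < size s) s`_i *~ a i.
Proof.
elim: s x => [|y s IHs] x /=; first by move=> ->; exists (fun _ => 0); rewrite big_ord0.
move=> [k /IHs[a aE]]; exists (fun i => if i is j.+1 then a j else k).
by rewrite big_ord_recl /= -aE addrC subrK.
Qed.

Lemma sum_zspan (s : seq G) (a : nat -> int) :
  zspan s (\sum_(i < size s) s`_i *~ a i).
Proof.
elim: s a => [|y s IHs] a /=; first by rewrite big_ord0.
by rewrite big_ord_recl /=; exists (a 0%N); rewrite addrC addKr; exact: (IHs (fun i => a i.+1)).
Qed.

Lemma irredundant_independent (s : seq G) : irredundant s ->
  (forall x, x \in s -> x *+ p = 0) ->
  forall a : nat -> int, \sum_(i < size s) s`_i *~ a i = 0 ->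
  forall i, (i < size s)%N -> (p%:Z %| a i)%Z.
Proof.
elim: s => // y s IHs [ny irs] sp a /=; rewrite big_ord_recl /= => s0.
have yp : y *+ p = 0 by apply: sp; rewrite inE eqxx.
have sp' x : x \in s -> x *+ p = 0 by move=> xs; apply: sp; rewrite inE xs orbT.
have hs := zspan_is_subgroup s.
have a0 : (p%:Z %| a 0%N)%Z.
  apply: contraT => /(ndvdz_coprime pp) pa; case: ny.
  apply: (@sg_coprime G _ y _ _ hs pa); first by rewrite -pmulrn yp; exact: sg0.
  move/eqP: s0; rewrite addr_eq0 => /eqP ->; apply: (sgN hs).
  exact: (sum_zspan s (fun i => a i.+1)).
move=> [//|i] /=; rewrite ltnS; apply: (IHs irs sp' (fun i => a i.+1)).
have /dvdzP[k aE] := a0.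
by move: s0; rewrite aE mulrC mulrzA -pmulrn yp mul0rz add0r.
Qed.

Lemma mulrz_Fp (x : G) (a : int) : x *+ p = 0 ->
  exists c : 'F_p, x *~ a = x *+ c.
Proof.
move=> xp; pose k := `|(a %% p%:Z)%Z|%N.
have kE : (k : int) = (a %% p%:Z)%Z.
  by rewrite /k gez0_abs // modz_ge0 // eqz_nat -lt0n prime_gt0.
exists k%:R; rewrite (divz_eq a p%:Z) mulrzDr mulrC mulrzA -pmulrn xp mul0rz add0r.
rewrite -kE -pmulrn val_Fp_nat // modn_small // -ltz_nat kE ltz_pmod //.
by rewrite ltz_nat prime_gt0.
Qed.

Lemma finite_prank_pcomponent :
  finitely_spanned (fun x : G => x *+ p = 0) ->
  finite_prank p (subgroup (pcomponent_subgroup G p)).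
Proof.
move=> /irredundant_spanning[s [irs sp sV]].
exists (size s).
have /choice[b bE] (i : 'I_(size s)) :
    exists u : subgroup (pcomponent_subgroup G p), val u = s`_i.
  by apply/subgroup_lift/socle_pcomponent/sp/mem_nth.
have bp i : b i *+ p = 0.
  by apply: val_inj; rewrite raddfMn raddf0 /= bE sp // mem_nth.
have sumE (c : {ffun 'I_(size s) -> 'F_p}) :
    val (\sum_i b i *+ c i) = \sum_(i < size s) s`_i *+ c i.
  by rewrite raddf_sum; apply: eq_bigr => i _; rewrite raddfMn /= bE.
exists b; split=> // x xp.
have vxp : val x *+ p = 0 by rewrite -raddfMn xp raddf0.
have [a aE] := zspan_sum (sV _ vxp).
have /choice[c cE] (i : 'I_(size s)) : exists c : 'F_p, s`_i *~ a i = s`_i *+ c.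
  by apply/mulrz_Fp/sp/mem_nth.
exists (finfun c); split.
  apply: val_inj; rewrite sumE aE; apply: eq_bigr => i _.
  by rewrite cE ffunE.
move=> c' /(congr1 val); rewrite sumE aE => sE.
apply/ffunP => i; rewrite ffunE; apply: val_inj.
have ltp (z : 'F_p) : (z < p)%N by rewrite -[X in (_ < X)%N](Fp_cast pp) ltn_ord.
(* The coefficient differences are extended by [0] to all of [nat], the index type of
   [irredundant_independent]. *)
pose d (j : nat) : int :=
  if insub j is Some i' then (c i' : nat)%:Z - (c' i' : nat)%:Z else 0.
have dE (j : 'I_(size s)) : d j = (c j : nat)%:Z - (c' j : nat)%:Z.
  by rewrite /d valK.
have := irredundant_independent irs sp (a := d) _ (ltn_ord i).
rewrite dE => dvd.
have : (p%:Z %| (c i : nat)%:Z - (c' i : nat)%:Z)%Z.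
  apply: dvd; transitivity (\sum_(j < size s) s`_j *~ a j - \sum_(j < size s) s`_j *+ c' j).
    by rewrite -sumrB; apply: eq_bigr => j _; rewrite dE mulrzBr cE.
  by rewrite sE subrr.
rewrite -eqz_mod_dvd !modz_nat eqz_nat !modn_small //.
by move/eqP.
Qed.
End FinitePrank.

Section DivisibleCase.
Variables (G : zmodType) (p : nat) (pp : prime p).
Local Notation T := (pcomponent_subgroup G p).
Hypothesis coG : semi_generalized_co_Bassian G.
Variable r : {additive G -> G}.
Hypotheses (rT : forall x, r x \in T) (r1 : forall x, x \in T -> r x = x).
Hypothesis ndiv : ~ p_divisible p {ideal_quot torsion_subgroup G}.
Hypothesis nT : ~ divisible (subgroup T).
Variables (n : nat) (D : zmodClosed G).
Hypotheses (divD : divisible (subgroup D))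
  (DT : forall x, x \in D -> exists2 y, y \in T & x = y *+ (p ^ n))
  (TD : forall y, y \in T -> y *+ (p ^ n) \in D).

(** If [D[p]] is infinite, [G[p]] embeds into it, and this extends to a map [G -> D] injective on
    [T_p]. By [socle_covered] with [b = n], [G[p]] then lies in [D], so [T_p = D] is divisible,
    against [nT]. *)
Lemma divisible_socle_spanned (s : seq G) :
  (forall x, x \in s -> x *+ p = 0) ->
  (forall x, x *+ p = 0 -> exists d, [/\ d \in D, d *+ p = 0 & zspan s (x - d)]) ->
  finitely_spanned (fun x => x *+ p = 0 /\ x \in D).
Proof.
move=> sp sD; apply: contrapT => nV.
have DsubT x : x \in D -> x \in T.
  by move=> /DT[y yT ->]; exact: rpredMn.
have hSoc : is_subgroup (fun x : G => x *+ p = 0).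
  by split=> [|x y x0 y0]; rewrite ?mul0rn // mulrnBl x0 y0 subrr.
have [Soc SocE] := sg_zmodClosed hSoc.
pose W : zmodType := subgroup Soc.
have pW (w : W) : w *+ p = 0.
  by apply: val_inj; rewrite raddfMn; apply/SocE; exact: valP.
pose V (w : W) := val w *+ p = 0 /\ val w \in D.
have hV : is_subgroup V.
  split; first by rewrite /V raddf0 mul0rn rpred0.
  move=> x y [xp xD] [yp yD]; rewrite /V raddfB.
  by rewrite mulrnBl xp yp subrr rpredB.
have nV' : ~ finitely_spanned V.
  move=> finV; apply: nV; apply: (@finitely_spanned_image _ Soc) => //.
  by move=> x [xp _]; apply/SocE.
have [t tE] : exists t : seq W, map val t = s.
  elim: (s) sp => [|y s' IHs] sp'; first by exists [::].
  have [|t tE] := IHs; first by move=> x xs; apply: sp'; rewrite inE xs orbT.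
  have /SocE yS : y *+ p = 0 by apply: sp'; rewrite inE eqxx.
  by have [u uy] := subgroup_lift yS; exists (u :: t); rewrite /= tE uy.
have spanE (t' : seq W) (w : W) : zspan (map val t') (val w) -> zspan t' w.
  elim: t' w => [|y t' IHt] w /=; first by move=> w0; exact: val_inj.
  by move=> [k sw]; exists k; apply: IHt; rewrite raddfB raddfMz.
have [|h [h_inj hVh]] := @embedding_of_finite_extension W p pp pW V hV nV' t.
  move=> w; have [|d [dD dp sd]] := sD (val w); first by apply/SocE; exact: valP.
  have [u uE] := subgroup_lift ((SocE d).2 dp).
  exists u; first by rewrite /V uE.
  by apply: spanE; rewrite tE raddfB /= uE.
have [|||b bE] := @additive_of_relation W (subgroup D) (fun w d => val d = val (h w)).
- by move=> x y x' y' xy xy'; rewrite !raddfB /= xy xy'.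
- by move=> y; rewrite !raddf0 => y0; exact: val_inj.
- by move=> x; have [_ xD] := hVh x; have [y yx] := subgroup_lift xD; exists y.
have [u u0|f fE] := @divisible_extension _ _ _ (val : {additive W -> G}) b divD.
  have -> : u = 0 by exact: val_inj.
  exact: raddf0.
have f_inj x : x \in T -> f x = 0 -> x = 0.
  apply: (@pgroup_inj G _ p f (fun x => x \in T)) => {x}.
  - by move=> x; exact: rpredMn.
  - by move=> x /in_pcomponent.
  - move=> x _ /SocE xS; have [w <-] := subgroup_lift xS.
    rewrite fE => /(congr1 val); rewrite bE raddf0 => w0.
    by rewrite (h_inj w) ?raddf0 //; exact: val_inj.
have socD x : x *+ p = 0 -> x \in D.
  move=> xp; have xT : x \in T by exact: socle_pcomponent.
  have [|y yT y0|t0 [g [t0p xE]]] :=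
      @socle_covered G p pp coG r rT r1 ndiv (val \o f) n x _ _ xp.
  - by move=> y _; apply/DsubT; exact: valP.
  - by apply: f_inj => //; exact: val_inj.
  have fD : val (f t0) \in D by exact: valP.
  rewrite xE rpredD //; apply: TD; apply: (@pcomponent_divX G p _ n).
  have -> : g *+ (p ^ n) = x - val (f t0) by rewrite xE /= addrK.
  by rewrite rpredB // DsubT.
have TsubD x : x \in T -> x \in D.
  move=> /in_pcomponent[k]; elim: k x => [|k IHk] x xk.
    by rewrite expn0 in xk; rewrite -[x]mulr1n xk rpred0.
  have xpD : x *+ p \in D by apply: IHk; rewrite -mulrnA -expnS.
  have [u ux] := subgroup_lift xpD.
  have [v /(congr1 val)] := divD (prime_gt0 pp) u.
  rewrite raddfMn /= ux => vx.
  have vD : val v \in D by exact: valP.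
  rewrite -[x](subrK (val v)) rpredD //; apply: socD.
  by rewrite mulrnBl vx subrr.
apply: nT => k k0 x; have [u ux] := subgroup_lift (TsubD _ (valP x)).
have [v /(congr1 val)] := divD k0 u; rewrite raddfMn /= ux => vx.
have [y yv] := subgroup_lift (DsubT _ (valP v)).
by exists y; apply: val_inj; rewrite raddfMn /= yv.
Qed.

(** The socle is filtered by its intersections with [p^k G]. Each step is finite by
    [homogeneous_socle_spanned], and the [n]-th term lies in [D]. *)
Lemma pcomponent_finite_prank : finite_prank p (subgroup T).
Proof.
apply: (finite_prank_pcomponent pp).
pose V k (x : G) := x *+ p = 0 /\ exists g, x = g *+ (p ^ k).
have hV k : is_subgroup (V k).
  apply: intersection_is_subgroup; last exact: multiples_of_is_subgroup.
  by split=> [|x y x0 y0]; rewrite ?mul0rn // mulrnBl x0 y0 subrr.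
have step k : exists2 s, forall x : G, x \in s -> x *+ p = 0 &
    forall x, V k x -> exists2 y, V k.+1 y & zspan s (x - y).
  have VSV x : V k.+1 x -> V k x.
    move=> [xp [g xg]]; split=> //; rewrite xg.
    by exists (g *+ p); rewrite -mulrnA -expnS.
  have [x [xp _]|_ ->|//|C [hC _ CV CS CS0]] := elementary_complement pp
    (hV k) (zero_is_subgroup G) (hV k.+1); [by []|exact: (sg0 (hV k))|].
  have [|||s sC Cs] := @homogeneous_socle_spanned G p pp coG r rT r1 ndiv k C hC.
  - by move=> v /CV[].
  - by move=> v /CV[].
  - by move=> v g Cv vg; apply: CS0 => //; split; [case: (CV v Cv) | exists g].
  exists s; first by move=> x /sC /CV[].
  move=> x Vx; have [c [y [Cc Vy ->]]] := CS x Vx.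
  by exists y => //; rewrite addrK; exact: Cs.
have [s sp sV] : exists2 s, forall x : G, x \in s -> x *+ p = 0 &
    forall x, x *+ p = 0 -> exists2 y, V n y & zspan s (x - y).
  elim: (n) => [|k [s sp sV]].
    exists [::] => // x xp; exists x; last by rewrite /= subrr.
    by split=> //; exists x.
  have [t tp tV] := step k; exists (t ++ s).
    by move=> x; rewrite mem_cat => /orP[/tp|/sp].
  move=> x /sV[y Vy sy]; have [z Vz tz] := tV y Vy; exists z => //.
  have := zspan_cat tz sy; rewrite addrC addrA subrK; exact.
have VnD x : V n x -> x \in D.
  move=> [xp [g xg]]; rewrite xg; apply: TD; apply: (@pcomponent_divX G p _ n).
  by rewrite -xg; exact: socle_pcomponent.
have [|t tp tV] := @divisible_socle_spanned s sp.
  by move=> x /sV[y Vy sy]; exists y; split=> //; [exact: VnD | case: Vy].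
exists (t ++ s).
  by move=> x; rewrite mem_cat => /orP[/tp[]|/sp].
move=> x xp; have [y Vy sy] := sV x xp.
rewrite -[x](subrK y) addrC; apply: zspan_cat => //; apply: tV.
by split; [case: Vy | exact: VnD].
Qed.
End DivisibleCase.

Lemma co_Bassian_pcomponent (G : zmodType) (p : nat) :
  prime p -> semi_generalized_co_Bassian G ->
  semi_generalized_co_Bassian (subgroup (pcomponent_subgroup G p)) /\
  (finite_prank p (subgroup (pcomponent_subgroup G p)) \/
   divisible (subgroup (pcomponent_subgroup G p)) \/
   p_divisible p {ideal_quot torsion_subgroup G}).
Proof.
move=> pp coG; have [n hn] := co_Bassian_stable_height pp coG.
have [r [rT r1]] := pcomponent_retract pp hn.
split; first exact: co_Bassian_retract rT r1 coG.
have [?|nT] := pselect (divisible (subgroup (pcomponent_subgroup G p))); first by right; left.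
have [?|ndiv] := pselect (p_divisible p {ideal_quot torsion_subgroup G}); first by right; right.
have [D [divD DT TD]] := divisible_part pp hn.
left; exact: (pcomponent_finite_prank pp coG rT r1 ndiv nT divD DT TD).
Qed.

(** * Sufficiency *)

Section Counting.
Variables (X Y : zmodType) (p : nat).
Hypothesis pX : forall x : X, exists k, x *+ (p ^ k) = 0.

Lemma finite_socle : finite_prank p X ->
  exists2 B : seq X, uniq B & forall x, x \in B <-> x *+ p = 0.
Proof.
move=> [n [b [bp bX]]].
pose comb (c : {ffun 'I_n -> 'F_p}) := \sum_i b i *+ c i.
exists (undup [seq comb c | c <- enum {: {ffun 'I_n -> 'F_p}}]); first exact: undup_uniq.
move=> x; rewrite mem_undup; split.
  move=> /mapP[c _ ->]; rewrite /comb -sumrMnl big1 // => i _.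
  by rewrite mulrnAC bp mul0rn.
by move=> /bX[c [-> _]]; apply: map_f; rewrite mem_enum.
Qed.

Lemma finite_power_torsion (B : seq X) k :
  (forall x, x \in B <-> x *+ p = 0) ->
  exists2 W : seq X, uniq W & forall x, x \in W <-> x *+ (p ^ k) = 0.
Proof.
move=> BE; elim: k => [|k [W _ WE]].
  exists [:: 0] => // x; rewrite inE expn0 mulr1n.
  by split=> [/eqP|->].
(* With a fixed solution [sel z] of [x *+ p = z] where one exists, [x] is determined by [x *+ p] and
   a socle element. *)
have /choice[sel selE] (z : X) : exists x, (exists x', x' *+ p = z) -> x *+ p = z.
  have [[x xz]|nx] := pselect (exists x, x *+ p = z); first by exists x.
  by exists 0.
pose U := [seq sel z + b | z <- W, b <- B].
exists (undup [seq x <- U | x *+ (p ^ k.+1) == 0]); first exact: undup_uniq.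
move=> x; rewrite mem_undup mem_filter; split=> [/andP[/eqP]//|xk].
rewrite xk eqxx /=; apply/allpairsP; exists (x *+ p, x - sel (x *+ p)) => /=; split.
- by apply/WE; rewrite -mulrnA -expnS.
- by apply/BE; rewrite mulrnBl selE ?subrr //; exists x.
- by rewrite addrC subrK.
Qed.

(** The [p]-rank does not increase under quotients: if [H0] is a finite part of
    the kernel of [q], then [x |-> p x] maps the elements that are killed by
    [p] modulo [H0] to [H0], with fibres of size at most [#|X[p]|]. *)
Lemma quotient_socle_surj (q phi : {additive X -> Y}) :
  finite_prank p X -> (forall y, exists x, q x = y) ->
  (forall x, phi x = 0 -> x = 0) ->
  forall y, y *+ p = 0 -> exists x, phi x = y.
Proof.
move=> /finite_socle[B uB BE] qsurj phi_inj y yp; apply: contrapT => ny.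
have [sec secE] := choice qsurj.
(* Preimages under [q] of one element more than [X[p]] has, all killed by [p] in [Y]. *)
pose Z := map sec (y :: map phi B).
have uZ : uniq Z.
  rewrite map_inj_uniq; last exact: can_inj secE.
  rewrite /= map_inj_uniq ?uB ?andbT; last exact: raddf_inj.
  by apply/mapP => -[b _ yb]; apply: ny; exists b.
have Zp z : z \in Z -> q (z *+ p) = 0.
  move=> /mapP[v vY ->]; rewrite raddfMn secE.
  move: vY; rewrite inE => /orP[/eqP ->//|/mapP[b /BE bp ->]].
  by rewrite -raddfMn bp raddf0.
have [k Zk] : exists k, forall z, z \in Z -> z *+ (p ^ k) = 0.
  elim: (Z) => [|z Z' [k Zk]]; first by exists 0%N.
  have [l zl] := pX z; exists (k + l)%N => x; rewrite inE expnD => /orP[/eqP ->|/Zk xk].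
    by rewrite mulnC mulrnA zl mul0rn.
  by rewrite mulrnA xk mul0rn.
have [W uW WE] := finite_power_torsion k BE.
have WD x x' : x \in W -> x' \in W -> x + x' \in W.
  by move=> /WE xW /WE xW'; apply/WE; rewrite mulrnDl xW xW' addr0.
(* The sets [z + H0] for [z] in [Z] are disjoint in [X1], while [X1] has at most [size H0 * size B]
   elements. *)
pose H0 := [seq x <- W | q x == 0]; pose X1 := [seq x <- W | q (x *+ p) == 0].
have H0_gt0 : (0 < size H0)%N.
  rewrite -has_predT; apply/hasP; exists 0 => //.
  by rewrite mem_filter raddf0 eqxx /=; apply/WE; rewrite mul0rn.
have /uniq_leq_size le1 : uniq [seq z + h | z <- Z, h <- H0].
  apply: allpairs_uniq => //; first exact: filter_uniq.
  move=> u u' /allpairsP[[z h] [zZ hH ->]] /allpairsP[[z' h'] [zZ' hH' ->]].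
  rewrite /uncurry [(z, h).1]/= [(z, h).2]/= [(z', h').1]/= [(z', h').2]/= in zZ hH zZ' hH' * => e.
  have zz : z = z'.
    move/(congr1 q): (e); move: hH hH'; rewrite !raddfD !mem_filter /=.
    move=> /andP[/eqP -> _] /andP[/eqP -> _]; rewrite !addr0.
    move: zZ zZ' => /mapP[v _ ->] /mapP[v' _ ->].
    by rewrite !secE => ->.
  by move: e; rewrite zz => /addrI ->.
have {}le1 : (size Z * size H0 <= size X1)%N.
  rewrite -(size_allpairs (fun z h => z + h)); apply: le1 => x.
  move=> /allpairsP[[z h] /= [zZ hH ->]].
  move: hH; rewrite !mem_filter => /andP[/eqP h0 hW].
  by rewrite mulrnDl raddfD /= Zp // raddfMn h0 mul0rn addr0 eqxx WD //; apply/WE/Zk.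
have /choice[sel selE] (z : X) : exists x, (exists x', x' *+ p = z) -> x *+ p = z.
  have [[x xz]|nx] := pselect (exists x, x *+ p = z); first by exists x.
  by exists 0.
pose g x := (x *+ p, x - sel (x *+ p)).
have /uniq_leq_size le2 : uniq [seq g x | x <- X1].
  rewrite map_inj_in_uniq; first exact: filter_uniq.
  by move=> x x' _ _ [-> /addIr].
have {}le2 : (size X1 <= size H0 * size B)%N.
  rewrite -(size_map g) -(size_allpairs (fun h b => (h, b))); apply: le2.
  move=> _ /mapP[x xX ->]; apply/allpairsP; exists (g x) => /=.
  move: xX; rewrite !mem_filter => /andP[-> xW]; split=> //.
    by apply/WE; rewrite mulrnAC (WE x).1 // mul0rn.
  by apply/BE; rewrite mulrnBl selE ?subrr //; exists x.
have := leq_trans le1 le2; rewrite mulnC leq_pmul2l //.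
by rewrite /Z size_map /= size_map ltnn.
Qed.
End Counting.

(** * Torsion kernel and torsion cokernel from finite rank *)

Section Rank.
Variables (G : zmodType) (hG : finite_torsion_free_rank G).
Variables (H : zmodClosed G) (phi : {additive G -> {ideal_quot H}}).
Hypothesis phi_inj : forall g, phi g = 0 -> g = 0.

Lemma torsion_of_multiple (A : zmodType) (x : A) (c : int) : c != 0 ->
  x *~ c \in torsion_subgroup A -> x \in torsion_subgroup A.
Proof.
move=> c0 /asboolP[k k0 xk]; apply/asboolP; exists (`|c| * k)%N.
  by rewrite muln_gt0 absz_gt0 c0.
rewrite mulrnA.
have [e|e] := absz_sign c.
- by rewrite (pmulrn x) e.
- by rewrite (pmulrn x) e mulrNz mulNrn xk oppr0.
Qed.

(** Let [b i] lift [phi (g i)], where the [g i] are a maximal independent family modulo torsion. Any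
    [x] and the [b i] are dependent modulo torsion, and independence of the [g i] makes the
    coefficient of [x] non-zero. *)
Lemma quotient_rank :
  (forall x, x \in H -> x \in torsion_subgroup G) /\
  (forall a, exists2 k, (0 < k)%N & exists g, phi g = a *+ k).
Proof.
have [n [[a ind] max]] := hG.
have /choice[g gE] (i : 'I_n) : exists g, quot_map (torsion_subgroup G) g = a i.
  exact: quot_map_surj.
have /choice[b bE] (i : 'I_n) : exists b, quot_map H b = phi (g i).
  exact: quot_map_surj.
have g_ind (c : 'I_n -> int) (k : nat) : (0 < k)%N ->
    (\sum_i g i *~ c i) *+ k = 0 -> forall i, c i = 0.
  move=> k0 s0; apply: ind.
  have /quot_map_eq0 : \sum_i g i *~ c i \in torsion_subgroup G.
    by apply/asboolP; exists k.
  by rewrite raddf_sum => e; rewrite -[RHS]e; apply: eq_bigr => i _; rewrite raddfMz gE.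
have dep x : exists (c0 : int) (c : 'I_n -> int) (k : nat), [/\ (0 < k)%N,
    quot_map H x *~ c0 *+ k = - phi ((\sum_i g i *~ c i) *+ k),
    (c0 = 0 -> exists i, c i != 0) &
    ((forall i, c i = 0) -> x *~ c0 \in torsion_subgroup G)].
  pose f (i : 'I_n.+1) := if unlift ord0 i is Some j
    then quot_map (torsion_subgroup G) (b j) else quot_map (torsion_subgroup G) x.
  have [c [s0 [i0 ci0]]] : exists c : 'I_n.+1 -> int, \sum_i f i *~ c i = 0 /\
      exists i, c i != 0.
    apply: contrapT => none; have := max n.+1 f; rewrite ltnn => /(_ _)/negP; apply=> //.
    move=> c s0 i; apply: contrapT => /eqP ci; apply: none; exists c; split=> //.
    by exists i.
  rewrite big_ord_recl /f unlift_none in s0.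
  have /quot_map_eq0 tx : quot_map (torsion_subgroup G)
      (x *~ c ord0 + \sum_(i < n) b i *~ c (lift ord0 i)) = 0.
    rewrite raddfD raddfMz raddf_sum -[RHS]s0; congr (_ + _).
    by apply: eq_bigr => i _; rewrite liftK raddfMz.
  have [k k0 xk] : exists2 k, (0 < k)%N &
      (x *~ c ord0 + \sum_(i < n) b i *~ c (lift ord0 i)) *+ k = 0 by apply/asboolP.
  exists (c ord0), (fun i => c (lift ord0 i)), k; split=> //.
  - apply/eqP; rewrite -addr_eq0; apply/eqP.
    have e := congr1 (quot_map H) xk.
    rewrite raddf0 raddfMn raddfD raddfMz raddf_sum in e.
    rewrite -[RHS]e raddfMn raddf_sum -mulrnDl; congr ((_ + _) *+ _).
    by apply: eq_bigr => i _; rewrite !raddfMz bE.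
  - move=> c0; move: ci0; case: (unliftP ord0 i0) => [j ->|->]; first by exists j.
    by rewrite c0 eqxx.
  - move=> c0; move: tx; rewrite big1 ?addr0 // => i _; by rewrite c0 mulr0z.
split.
  move=> x /quot_map_eq0 x0; have [c0 [c [k [k0 xE c0E cE]]]] := dep x.
  have c_eq0 : forall i, c i = 0.
    apply: (g_ind c k k0); apply: phi_inj.
    move/eqP: xE; rewrite x0 mul0rz mul0rn eq_sym oppr_eq0 => /eqP; exact.
  have nc0 : c0 != 0.
    by apply/negP => /eqP /c0E[i]; rewrite c_eq0 eqxx.
  exact: torsion_of_multiple nc0 (cE c_eq0).
move=> y; have [x <-] := quot_map_surj y; have [c0 [c [k [k0 xE c0E _]]]] := dep x.
have nc0 : c0 != 0.
  apply/negP => /eqP c00; have [i] := c0E c00.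
  rewrite (g_ind c k k0) ?eqxx //; apply: phi_inj.
  move/eqP: xE; rewrite c00 mulr0z mul0rn eq_sym oppr_eq0 => /eqP; exact.
exists (`|c0| * k)%N; first by rewrite muln_gt0 absz_gt0 nc0.
rewrite mulrnA.
have [e|e] := absz_sign c0.
- by rewrite (pmulrn (quot_map H x)) e xE -raddfN; eexists.
- by rewrite (pmulrn (quot_map H x)) e mulrNz mulNrn xE opprK; eexists.
Qed.
End Rank.

Lemma pcomponent_restriction (G A : zmodType) (p : nat) (f : {additive G -> A}) :
  exists fp : {additive subgroup (pcomponent_subgroup G p) ->
                        subgroup (pcomponent_subgroup A p)},
    forall u, val (fp u) = f (val u).
Proof.
have [|||fp fpE] := @additive_of_relation (subgroup (pcomponent_subgroup G p))
  (subgroup (pcomponent_subgroup A p)) (fun u v => val v = f (val u)).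
- by move=> x y x' y' xy xy'; rewrite !raddfB /= xy xy'.
- by move=> y; rewrite !raddf0 => y0; exact: val_inj.
- move=> x; have fx : f (val x) \in pcomponent_subgroup A p.
    have /in_pcomponent[k xk] := valP x.
    by apply/in_pcomponent; exists k; rewrite -raddfMn xk raddf0.
  by have [y yE] := subgroup_lift fx; exists y.
by exists fp.
Qed.

Lemma pcomponent_torsion (G : zmodType) (p : nat)
  (u : subgroup (pcomponent_subgroup G p)) : exists k, u *+ (p ^ k) = 0.
Proof.
have /in_pcomponent[k uk] := valP u; exists k.
by apply: val_inj; rewrite raddfMn raddf0.
Qed.

Lemma pcomponent_coprime_eq0 (G : zmodType) (p m : nat) (x : G) :
  prime p -> ~~ (p %| m)%N -> x \in pcomponent_subgroup G p -> x *+ m = 0 -> x = 0.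
Proof.
move=> pp pm /in_pcomponent[k xk]; apply: coprime_torsion_eq0 xk.
by apply: coprimeXl; rewrite prime_coprime.
Qed.

(** * Assembling the summand prime by prime *)

Section Reverse.
Variables (G A : zmodType) (q phi : {additive G -> A}).
Hypothesis q_surj : forall a, exists g, q g = a.
Hypothesis q_ker : forall g, q g = 0 -> g \in torsion_subgroup G.
Hypothesis phi_inj : forall g, phi g = 0 -> g = 0.
Hypothesis phi_tors : forall a, exists2 k, (0 < k)%N & exists g, phi g = a *+ k.

Section Local.
Variables (p : nat) (pp : prime p).
Local Notation T := (pcomponent_subgroup G p).
Local Notation Ap := (pcomponent_subgroup A p).
Hypothesis coT : semi_generalized_co_Bassian (subgroup T).
Hypothesis cases : finite_prank p (subgroup T) \/ divisible (subgroup T) \/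
  p_divisible p {ideal_quot torsion_subgroup G}.

(** A preimage of [a] is torsion because the kernel of [q] is; its prime-to-[p] part is removed by a
    multiple that acts as [1] on [a]. *)
Lemma pcomponent_onto a : a \in Ap -> exists2 t, t \in T & q t = a.
Proof.
move=> /in_pcomponent[k ak]; have [g gE] := q_surj a.
have /asboolP[n n0 gn] : g \in torsion_subgroup G.
  have : g *+ (p ^ k) \in torsion_subgroup G by apply: q_ker; rewrite raddfMn gE.
  move=> /asboolP[m m0 gm]; apply/asboolP; exists (p ^ k * m)%N.
    by rewrite muln_gt0 expn_gt0 prime_gt0.
  by rewrite mulrnA.
have [e [m [pm nE]]] := prime_part pp n0.
have [u uE] := pgroup_coprime_div pp pm ak.
exists (g *~ u *+ m).
  apply/in_pcomponent; exists e.
  by rewrite -mulrnA mulnC pmulrn mulrzAC -pmulrn -nE gn mul0rz.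
by rewrite raddfMn raddfMz /= gE.
Qed.

(** From [a *+ n = phi g] with [n = p ^ e * m], [p]-divisibility writes [g] as [g1 *+ (p ^ e)] plus
    torsion, so [a *+ m - phi g1] is torsion; a further factor prime to [p] moves it into [A_p]. *)
Lemma p_divisible_factor a : p_divisible p {ideal_quot torsion_subgroup G} ->
  exists m, ~~ (p %| m)%N /\ exists g b, b \in Ap /\ a *+ m = phi g + b.
Proof.
move=> pdiv; have [n n0 [g gE]] := phi_tors a.
have [e [m [pm nE]]] := prime_part pp n0.
have [g1 [t [k [k0 tk gt]]]] : exists g1 t k, [/\ (0 < k)%N, t *+ k = 0 &
    g = g1 *+ (p ^ e) + t].
  have [y yE] : exists y, y *+ (p ^ e) = quot_map (torsion_subgroup G) g.
    elim: (e) => [|i [y yE]]; first by eexists; exact: mulr1n.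
    by have [z zy] := pdiv y; exists z; rewrite expnS mulrnA zy.
  have [g1 g1E] := quot_map_surj y.
  have /quot_map_eq0/asboolP[k k0 tk] :
      quot_map (torsion_subgroup G) (g - g1 *+ (p ^ e)) = 0.
    by rewrite raddfB raddfMn g1E yE subrr.
  by exists g1, (g - g1 *+ (p ^ e)), k; split=> //; rewrite addrC subrK.
have [f [m' [pm' kE]]] := prime_part pp k0.
pose z := a *+ m - phi g1.
have zp : z *+ (p ^ e) = phi t.
  by rewrite mulrnBl -mulrnA mulnC -nE -gE gt raddfD raddfMn addrAC subrr add0r.
exists (m * m')%N; split; first by rewrite Euclid_dvdM // negb_or pm pm'.
exists (g1 *+ m'), (z *+ m'); split.
  apply/in_pcomponent; exists (e + f)%N.
  rewrite -mulrnA expnD mulnCA [(m' * _)%N]mulnC mulrnA zp -kE -raddfMn tk.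
  exact: raddf0.
by rewrite mulrnA raddfMn -mulrnDl addrC subrK.
Qed.

(** On the [p]-component this is the projection onto a complement of the
    summand in which [phi T_p] is essential; in each of the three cases it
    extends to all of [A] while killing [phi G]. *)
Lemma local_projection : exists r : {additive A -> A},
  [/\ forall g, r (phi g) = 0, forall a, r a \in Ap, forall a, r (r a) = r a &
      forall x, x *+ p = 0 -> r x = 0 -> exists g, phi g = x].
Proof.
have [qp qpE] := pcomponent_restriction p q.
have [php phpE] := pcomponent_restriction p phi.
have qp_surj u : exists t, qp t = u.
  have [t tT tE] := pcomponent_onto (valP u); have [v vE] := subgroup_lift tT.
  by exists v; apply: val_inj; rewrite qpE vE.
have php_inj u : php u = 0 -> u = 0.
  move=> u0; apply: val_inj; rewrite raddf0; apply: phi_inj.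
  by rewrite -phpE u0 raddf0.
have [r [rr rphi ess]] := co_Bassian_onto coT qp_surj php_inj.
have hL : is_subgroup (fun a => exists u, val u = a /\ r u = 0).
  split; first by exists 0; rewrite !raddf0.
  move=> _ _ [u [<- ru]] [v [<- rv]]; exists (u - v).
  by rewrite !raddfB ru rv subrr.
have [L LE] := sg_zmodClosed hL.
have phi_pcomp g : phi g \in Ap -> exists t : subgroup T, val t = g.
  move=> /in_pcomponent[k gk]; apply/subgroup_lift/in_pcomponent; exists k.
  by apply: phi_inj; rewrite raddfMn.
(* The projection is prescribed on [phi G + A_p]: zero on [phi G] and [u - r u] on [A_p]. This is
   consistent since [phi G] meets [A_p] in [phi T_p], which [r] fixes. *)
have [al alE] : exists al : {additive (G * subgroup Ap)%type -> A},
    al =1 (fun z => phi z.1 + val z.2).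
  by apply: additive_of_morphism => x y; rewrite !raddfB /= addrBACA.
have [|||be beE] := @additive_of_relation (G * subgroup Ap)%type (subgroup L)
  (fun z w => val w = val (z.2 - r z.2)).
- move=> [x1 x2] y [x1' x2'] y' /= xy xy'.
  by rewrite !raddfB /= in xy xy' *; rewrite xy xy' !opprD !opprK addrACA.
- move=> y y0; apply: val_inj; apply: etrans y0 _.
  have -> : (0 : (G * subgroup Ap)%type).2 = 0 by [].
  by rewrite raddf0 subrr.
- move=> z; have zL : val (z.2 - r z.2) \in L.
    by apply/LE; exists (z.2 - r z.2); split; rewrite // raddfB rr subrr.
  by have [w wE] := subgroup_lift zL; exists w.
have kerP z : al z = 0 -> be z = 0.
  rewrite alE => /eqP; rewrite addr_eq0 => /eqP phE.
  have [|t tE] := phi_pcomp z.1; first by rewrite phE rpredN; exact: valP.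
  have zE : z.2 = php (- t).
    by apply: val_inj; rewrite phpE !raddfN /= tE phE opprK.
  by apply: val_inj; rewrite beE zE rphi subrr.
have L_torsion (w : subgroup L) : exists k, w *+ (p ^ k) = 0.
  have /LE[u [uw _]] := valP w; have [k uk] := pcomponent_torsion u.
  exists k; apply: val_inj; rewrite raddfMn /= -[sval w]uw.
  by rewrite -raddfMn uk !raddf0.
have [f fE] : exists f : {additive A -> subgroup L}, forall z, f (al z) = be z.
  case: cases => [fin|[div|pdiv]].
  - have r_inj u : r u = 0 -> u = 0.
      apply: (@pgroup_inj _ _ p r (fun _ => True)) => // {u} u _.
        exact: pcomponent_torsion.
      move=> up u0; have [|t tE] := @quotient_socle_surj _ _ p _ qp php fin qp_surj php_inj u up.
        exact: pcomponent_torsion.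
      by move: u0; rewrite -tE rphi.
    apply: extend_additive kerP _ => x d w _ _; exists 0.
    have /LE[u [uw /r_inj u0]] := valP w.
    by apply: val_inj; rewrite mul0rn raddf0 -[val w]uw u0 raddf0.
  (* In case (b) [L] is an image of [T_p], hence divisible. *)
  - apply: divisible_extension kerP => n n0 w.
    have /LE[u [uw ru]] := valP w; have [t tE] := qp_surj u.
    have [t' t'E] := div n n0 t.
    have uL : val (qp t' - r (qp t')) \in L.
      by apply/LE; exists (qp t' - r (qp t')); split; rewrite // raddfB rr subrr.
    have [y yE] := subgroup_lift uL; exists y; apply: val_inj.
    by rewrite raddfMn /= yE -raddfMn mulrnBl -!raddfMn t'E tE ru subr0.
  (* In case (c) some multiple of [x] prime to [p] is in the domain, so [d] is prime to [p] and acts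
     invertibly on [L]. *)
  - apply: extend_additive kerP _ => x d w dvd _.
    have [m [pm [g [b [bA xm]]]]] := p_divisible_factor x pdiv.
    have [v vE] := subgroup_lift bA.
    have dm : (d %| m)%N by apply: (dvd _ (g, v)); rewrite alE /= vE.
    have pd : ~~ (p %| d)%N by apply: contra pm => pd; exact: dvdn_trans dm.
    have [k wk] := L_torsion w.
    by have [u uE] := pgroup_coprime_div pp pd wk; exists (w *~ u).
have fphi g : f (phi g) = 0.
  have <- : al (g, 0) = phi g by rewrite alE; exact: addr0.
  rewrite fE; apply: val_inj; apply: etrans (beE _) _.
  by rewrite [r _]raddf0 subrr.
have fL u : val (f (val u)) = val (u - r u).
  have <- : al (0, u) = val u by rewrite alE raddf0; exact: add0r.
  by rewrite fE beE.
exists (val \o f); split=> /=.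
- by move=> g; rewrite fphi.
- by move=> a; have /LE[u [<- _]] := valP (f a); exact: valP.
- by move=> a; have /LE[u [<- ru]] := valP (f a); rewrite fL ru subr0.
move=> x xp fx; have [u uE] := subgroup_lift (socle_pcomponent xp).
have ru : r u = u.
  apply/eqP; rewrite eq_sym -subr_eq0; apply/eqP/val_inj.
  by rewrite raddf0 -fL uE; exact: fx.
have [u0|u0] := eqVneq u 0; first by exists 0; rewrite -uE u0 !raddf0.
have [k [t [tE uk]]] := ess u ru u0.
have up : u *+ p = 0 by apply: val_inj; rewrite raddfMn /= uE xp.
have [/dvdzP[j kE]|/(ndvdz_coprime pp) pk] := boolP (p%:Z %| k)%Z.
  by case/eqP: uk; rewrite kE mulrC mulrzA -pmulrn up mul0rz.
pose S (v : subgroup Ap) := exists t, php t = v.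
have hS : is_subgroup S := image_is_subgroup _.
have [||t' t'E] := @sg_coprime _ S u _ _ hS pk.
- by exists 0; rewrite raddf0 -pmulrn up.
- by exists t.
- by exists (val t'); rewrite -phpE t'E uE.
Qed.
End Local.

Hypothesis local : forall p, prime p ->
  semi_generalized_co_Bassian (subgroup (pcomponent_subgroup G p)) /\
  (finite_prank p (subgroup (pcomponent_subgroup G p)) \/
   divisible (subgroup (pcomponent_subgroup G p)) \/
   p_divisible p {ideal_quot torsion_subgroup G}).

(** Each element has only finitely many non-zero projections [r p], and these are orthogonal
    idempotents, so the common kernel has the sum of their images as complement. *)
Lemma essential_in_summand : exists2 K : zmodClosed A,
  direct_summand K & essential_in (image_subgroup phi) K.
Proof.
have /choice[r rP] (p : nat) : exists r : {additive A -> A}, prime p ->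
    [/\ forall g, r (phi g) = 0, forall a, r a \in pcomponent_subgroup A p,
        forall a, r (r a) = r a &
        forall x, x *+ p = 0 -> r x = 0 -> exists g, phi g = x].
  have [pp|np] := boolP (prime p); last by exists idfun.
  by have [coT cases] := local pp; have [r rP] := local_projection pp coT cases; exists r.
(* [r p a] is killed by [k], and a prime [p] above [k] does not divide it. *)
have r_big p a k : prime p -> (0 < k)%N -> (k < p)%N ->
    (exists g, phi g = a *+ k) -> r p a = 0.
  move=> pp k0 kp [g gE]; have [rphi rA _ _] := rP p pp.
  apply: (@pcomponent_coprime_eq0 A p k) => //.
    by rewrite gtnNdvd.
  by rewrite -raddfMn -gE rphi.
have r_ortho p p' a : prime p -> prime p' -> p != p' -> r p (r p' a) = 0.
  move=> pp pp' neq; have [_ rA _ _] := rP p pp; have [_ rA' _ _] := rP p' pp'.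
  have /in_pcomponent[k ak] := rA' a.
  apply: (@pcomponent_coprime_eq0 A p (p' ^ k)) => //.
    by apply: contra neq; rewrite Euclid_dvdX // dvdn_prime2 // => /andP[].
  by rewrite -raddfMn ak raddf0.
pose proj n a := \sum_(0 <= p < n | prime p) r p a.
have r_proj p n a : prime p -> r p (proj n a) = if (p < n)%N then r p a else 0.
  move=> pp; rewrite /proj big_mkcond raddf_sum /=; have [_ _ rr _] := rP p pp.
  have E i : r p (if prime i then r i a else 0) = if i == p then r p a else 0.
    have [->|ne] := eqVneq i p; first by rewrite pp rr.
    by case: ifP => pi; [rewrite r_ortho // eq_sym | rewrite raddf0].
  rewrite (eq_bigr _ (fun i _ => E i)); elim: n => [|n IHn]; first by rewrite big_geq.
  rewrite big_nat_recr //= IHn ltnS; have [_|_|->] := ltngtP p n.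
  - by rewrite addr0.
  - by rewrite addr0.
  - by rewrite add0r.
have hK : is_subgroup (fun a => forall p, prime p -> r p a = 0).
  split=> [p _|a b ra rb p pp]; first by rewrite raddf0.
  by rewrite raddfB ra // rb // subrr.
(* The sum of the images of the [r p]: its members are the elements equal to the sum of their own
   projections. *)
have hL : is_subgroup (fun a => exists N, forall M, (N <= M)%N -> a = proj M a).
  split.
    by exists 0%N => M _; rewrite /proj big1 // => p _; rewrite raddf0.
  move=> a b [N aN] [N' bN']; exists (maxn N N') => M.
  rewrite geq_max => /andP[/aN aE /bN' bE].
  rewrite {1}aE {1}bE /proj -sumrB.
  by apply: eq_bigr => p _; rewrite raddfB.
have [K KE] := sg_zmodClosed hK; have [L LE] := sg_zmodClosed hL.
exists K.
  exists L; split=> [x /KE rx /LE[N xN]|x].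
    by rewrite (xN N (leqnn N)) /proj big1 // => p pp; rewrite rx.
  have [k k0 xk] := phi_tors x; exists (x - proj k.+1 x), (proj k.+1 x).
  have r_projE p : prime p -> r p (proj k.+1 x) = r p x.
    move=> pp; rewrite r_proj //; case: ltnP => // kp.
    by rewrite (r_big p x k).
  split; last by rewrite subrK.
    by apply/KE => p pp; rewrite raddfB /= r_projE // subrr.
  apply/LE; exists k.+1 => M kM; rewrite {2}/proj (eq_bigr _ r_projE).
  rewrite /proj (big_cat_nat _ kM) //= [X in _ + X]big1_seq ?addr0 // => p.
  rewrite mem_index_iota => /andP[pp /andP[kp _]].
  by rewrite (r_big p x k).
split=> [_ /asboolP[g <-]|S SK [x xS x0]].
  by apply/KE => p pp; have [rphi _ _ _] := rP p pp.
have hS := closed_is_subgroup S.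
have [k k0 [g gE]] := phi_tors x.
have [xk|xk] := eqVneq (x *+ k) 0; last first.
  by exists (x *+ k); split=> //; [apply/asboolP; exists g | exact: (sgMn hS)].
(* For torsion [x], a multiple of prime order [p] is taken; lying in the kernel of [r p], it is in
   the image of [phi]. *)
have ex : exists n, (0 < n)%N && (x *+ n == 0) by exists k; rewrite k0 xk eqxx.
case: (ex_minnP ex) => n /andP[n0 /eqP xn] nmin.
have n1 : (1 < n)%N.
  rewrite ltn_neqAle n0 andbT eq_sym; apply: contra x0 => /eqP n1.
  by rewrite -[x]mulr1n -n1 xn.
pose p := pdiv n; have pp : prime p by exact: pdiv_prime.
have nE : n = (n %/ p * p)%N by rewrite divnK // pdiv_dvd.
have y0 : x *+ (n %/ p) != 0.
  apply/negP => y0; have := nmin (n %/ p)%N; rewrite y0 andbT.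
  rewrite divn_gt0 ?prime_gt0 // dvdn_leq ?pdiv_dvd // => /(_ isT).
  by rewrite leqNgt ltn_Pdiv // prime_gt1.
have yS : x *+ (n %/ p) \in S by exact: (sgMn hS).
have [_ _ _ soc] := rP p pp.
have [||g' g'E] := soc (x *+ (n %/ p)).
- by rewrite -mulrnA -nE.
- by have /KE := SK _ yS; apply.
by exists (x *+ (n %/ p)); split=> //; apply/asboolP; exists g'.
Qed.
End Reverse.

Theorem theorem2p9 (G : zmodType) (hG : finite_torsion_free_rank G) :
  semi_generalized_co_Bassian G <->
  (forall p : nat, prime p ->
     semi_generalized_co_Bassian (subgroup (pcomponent_subgroup G p)) /\
     (finite_prank p (subgroup (pcomponent_subgroup G p)) \/
      divisible (subgroup (pcomponent_subgroup G p)) \/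
      p_divisible p {ideal_quot torsion_subgroup G})).
Proof.
split=> [coG p pp|local H phi phi_inj]; first exact: co_Bassian_pcomponent.
have inj0 g : phi g = 0 -> g = 0 by rewrite -(raddf0 phi) => /phi_inj.
have [HT phi_tors] := quotient_rank hG inj0.
apply: (@essential_in_summand G _ (quot_map H)) => //; first exact: quot_map_surj.
by move=> g /quot_map_eq0; exact: HT.
Qed.
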